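(* Let $p(x,y)=\sum_{\alpha, |\beta|\leq 2} c_{\alpha,\beta}x^\alpha y^\beta$ be a polynomial that is nonnegative on $\mathbb{R}^n \times \mathbb{R}^m$, quadratic and correlatively sparse in $y$, and such that $\sum_{\alpha, |\beta| = 2} c_{\alpha,\beta}x^\alpha y^\beta$ is nonnegative on $\mathbb{R}^n\times\mathbb{R}^m$. If the correlative sparsity graph of $p$ with respect to $y$ is chordal with maximal cliques $\mathcal{C}_1,\ldots,\mathcal{C}_t$, then there exist an SOS polynomial $\sigma_0(x)$ and SOS polynomials $\sigma_k(x,y_{\mathcal{C}_k})$, $k=1,\ldots,t$, quadratic in the second argument, such that $$\sigma_0(x) p(x,y) = \sum_{k=1}^t \sigma_k\left(x, y_{\mathcal{C}_k}\right).$$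
   Context: Polynomials have real coefficients, $x=(x_1,\ldots,x_n)$, $y=(y_1,\ldots,y_m)$; $\alpha\in\mathbb{N}^n$, $\beta\in\mathbb{N}^m$ are multi-indices, $|\beta|=\beta_1+\cdots+\beta_m$, and sums are finite. ''Quadratic'' in a variable means of degree at most $2$ in it. The coupling matrix $\mathrm{CSP}_y(p)\in\{0,1\}^{m\times m}$ has $(i,j)$ entry $1$ if $i=j$ or there exist $\alpha,\beta$ with $\beta_i\beta_j\neq 0$ and $c_{\alpha,\beta}\neq0$, and $0$ otherwise. The correlative sparsity graph of $p$ with respect to $y$ is the undirected graph with vertices $\{1,\ldots,m\}$ whose edges are the pairs $i\ne j$ with $[\mathrm{CSP}_y(p)]_{ij}=1$; ''correlatively sparse'' means merely that $\mathrm{CSP}_y(p)$ is sparse. A clique is a set of pairwise adjacent vertices; it is maximal if not contained in another clique. A graph is chordal if every cycle of length at least $4$ has an edge joining two nonconsecutive vertices. For a clique $\mathcal{C}$, $y_{\mathcal{C}}$ is the subvector of $y$ indexed by $\mathcal{C}$. An SOS polynomial is a finite sum of squares of polynomials. *)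

(* Defs.v *)
From HB Require Import structures.
From mathcomp Require Import all_boot all_order all_algebra.
From mathcomp Require Import reals.
From mathcomp Require Import mpoly.

Set Implicit Arguments.
Unset Strict Implicit.
Unset Printing Implicit Defensive.

Import Order.TTheory GRing.Theory Num.Theory.

Local Open Scope ring_scope.

(* A polynomial in (x, y), x = (x_1..x_n) and y = (y_1..y_m), is an element of
   {mpoly R[n + m]}: the first n variables are x, the last m are y.  For a
   monomial mu = (alpha, beta), beta_j is [mu (rshift n j)]. *)

Definition ydeg (n m : nat) (mu : 'X_{1..n + m}) : nat :=
  (\sum_(j < m) mu (rshift n j))%N.

Definition quadratic_y (R : realType) (n m : nat) (p : {mpoly R[n + m]}) : Prop :=
  forall mu, mu \in msupp p -> (ydeg mu <= 2)%N.

Definition ypart (R : realType) (n m d : nat) (p : {mpoly R[n + m]}) :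
    {mpoly R[n + m]} :=
  \sum_(mu <- msupp p | ydeg mu == d) p@_mu *: 'X_[mu].

Definition joint (R : realType) (n m : nat) (x : 'I_n -> R) (y : 'I_m -> R)
    (i : 'I_(n + m)) : R :=
  match split i with inl j => x j | inr k => y k end.

Definition nonneg_xy (R : realType) (n m : nat) (p : {mpoly R[n + m]}) : Prop :=
  forall (x : 'I_n -> R) (y : 'I_m -> R), 0 <= p.@[joint x y].

Definition is_sos (R : realType) (k : nat) (p : {mpoly R[k]}) : Prop :=
  exists s : seq {mpoly R[k]}, p = \sum_(q <- s) q ^+ 2.

Definition CSP (R : realType) (n m : nat) (p : {mpoly R[n + m]}) : 'M[bool]_m :=
  \matrix_(i, j) ((i == j) ||
    has (fun mu : 'X_{1..n + m} => (mu (rshift n i) * mu (rshift n j) != 0)%N)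
        (msupp p)).

Definition csgraph (R : realType) (n m : nat) (p : {mpoly R[n + m]}) : rel 'I_m :=
  [rel i j | (i != j) && CSP p i j].

(* For an irreflexive symmetric [e]; [s] lists the distinct vertices of the
   cycle in order, so consecutive vertices are those related by [next s]. *)
Definition chordal (T : finType) (e : rel T) : Prop :=
  forall s : seq T, (4 <= size s)%N -> ucycle e s ->
  exists u v, [/\ u \in s, v \in s, e u v, v != next s u & u != next s v].

Definition is_clique (T : finType) (e : rel T) (A : {set T}) : bool :=
  [forall u in A, forall v in A, (u != v) ==> e u v].

Definition max_clique (T : finType) (e : rel T) (A : {set T}) : bool :=
  maxset (is_clique e) A.

Definition lift_x (R : realType) (n m : nat) (s : {mpoly R[n]}) :
    {mpoly R[n + m]} :=
  s \mPo [tuple 'X_(lshift m i) | i < n].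

(* A polynomial in (x, y_A) is an element of {mpoly R[n + #|A|]}, the variables
   y_A being listed in the order of [enum A]. *)
Definition lift_xy (R : realType) (n m : nat) (A : {set 'I_m})
    (s : {mpoly R[n + #|A|]}) : {mpoly R[n + m]} :=
  s \mPo [tuple match split i with
                | inl j => 'X_(lshift m j)
                | inr k => 'X_(rshift n (enum_val k))
                end | i < n + #|A|].

(* Main.v *)
(* Write p = a y_v^2 + b y_v + c with v a simplicial vertex of the sparsity
   graph, which exists by Dirac's theorem. Then 4 a p = (2 a y_v + b)^2 + r with
   r = 4 a c - b^2, where b involves only the neighbours of v. As the negative of a
   discriminant, r is again nonnegative, and since the neighbours of v form a
   clique its sparsity graph is contained in that of p minus v: this is Gaussian
   elimination without fill-in. Induction on the number of y-variables reduces
   everything to multiplying the nonnegative polynomials a(x) and, at the end,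
   c(x) by sums of squares so that they become sums of squares, which is
   Hilbert's 17th problem.

   For the latter (Artin), suppose that f has no such multiplier. Then the
   fractions (s - t f) / h^2, with s and t sums of squares, form a precone in any
   field containing R[x]. In an algebraically closed field (an ultrapower of
   R[i]) extend it to a maximal precone by Zorn's lemma: this is the set of
   nonnegative elements of a real closed subfield, in which f < 0 at the point x.
   Cohen-Hormander quantifier elimination transfers such a point to R. *)

Require Import Defs.
From HB Require Import structures.
From mathcomp Require Import all_boot all_order all_algebra.
From mathcomp Require Import reals.
From mathcomp Require Import mpoly.
From mathcomp Require Import boolp.
From mathcomp Require classical_sets functions filter.
From mathcomp Require Import ring_quotient polyrcf complex.
From mathcomp Require Import ring lra.

Set Implicit Arguments.
Unset Strict Implicit.
Unset Printing Implicit Defensive.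

Import Order.TTheory GRing.Theory Num.Theory.

Local Open Scope ring_scope.

(** Several obstacles shape the proof. Quantifier elimination serves only to compare two real closed
    fields, so it is stated without formulas: finitely many ring elements are found whose signs
    determine a sign diagram under specialization to any two such fields. In an algebraically closed
    field -1 is a square, so a cone there cannot contain all squares; a precone is only asked to
    contain the squares of differences of its own elements. That a maximal one yields a real closed
    field rests on a fact about division: a polynomial that changes sign never divides 1 plus a sum
    of squares with nonnegative weights. The ultrapower is convenient because it inherits algebraic
    closedness from R[i] pointwise and contains R[x] through evaluation, provided that the
    ultrafilter contains the nonvanishing set of every nonzero polynomial. In the elimination of y
    the graph stays fixed and only the set of remaining vertices shrinks, so that chordality is used
    for one graph. The coefficient a may vanish identically; nonnegativity then makes b vanish too,
    and y_v does not occur at all. *)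

(** * Signs and the mean value theorem *)

Section SignAgreement.
Variables (M N : realDomainType).
Implicit Types (x : M) (y : N).

Lemma eq_sgz_lt0 x y : sgz x = sgz y -> (x < 0) = (y < 0).
Proof. by move=> e; rewrite -sgz_lt0 e sgz_lt0. Qed.

Lemma eq_sgz_gt0 x y : sgz x = sgz y -> (0 < x) = (0 < y).
Proof. by move=> e; rewrite -sgz_gt0 e sgz_gt0. Qed.

Lemma eq_sgz_eq0 x y : sgz x = sgz y -> (x == 0) = (y == 0).
Proof. by move=> e; rewrite -sgz_eq0 e sgz_eq0. Qed.

Lemma eq_sgzN x y : sgz x = sgz y -> sgz (- x) = sgz (- y).
Proof. by rewrite !sgzN => ->. Qed.

End SignAgreement.

Lemma poly_mvt_neq (M : rcfType) (p : {poly M}) (u v : M) : u != v ->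
  exists2 c, (u < c < v) || (v < c < u) & p.[u] - p.[v] = p^`().[c] * (u - v).
Proof.
wlog uv : u v / u < v => [W|_].
  rewrite neq_lt => /orP[uv|vu]; first by apply: (W u v uv); rewrite lt_eqF.
  have [|c cvu e] := W v u vu; first by rewrite (lt_eqF vu).
  by exists c; [rewrite orbC | rewrite -opprB e -mulrN opprB].
have [c cuv e] := poly_mvt p uv; exists c.
  by move: cuv; rewrite in_itv /= => cuv; apply/orP; left.
by rewrite -opprB e -mulrN opprB.
Qed.

(** * Sign diagrams over a pair of real closed fields *)

(* A list Z of pairs matches finitely many points of M with points of N; u and v
   lie in the same cut when they are placed alike with respect to Z. Keeping the
   points as an unsorted list of pairs avoids sorted lists of roots. *)
Definition same_cut (M N : rcfType) (Z : seq (M * N)) (u : M) (v : N) :=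
  forall z, z \in Z -> sgz (u - z.1) = sgz (v - z.2).

Definition swap_pairs (S T : eqType) (Z : seq (S * T)) : seq (T * S) :=
  [seq (z.2, z.1) | z <- Z].

Lemma mem_swap_pairs (S T : eqType) (Z : seq (S * T)) x y :
  ((y, x) \in swap_pairs Z) = ((x, y) \in Z).
Proof.
by apply/mapP/idP => [[[a b] ab [-> ->]] //|xy]; exists (x, y).
Qed.

Definition compatible (M N : rcfType) (Z : seq (M * N)) :=
  forall z, z \in Z -> same_cut Z z.1 z.2.

Lemma same_cut_swap (M N : rcfType) (Z : seq (M * N)) u v :
  same_cut Z u v -> same_cut (swap_pairs Z) v u.
Proof. by move=> uv [b a]; rewrite mem_swap_pairs => /uv /= ->. Qed.

Lemma same_cut_swapK (M N : rcfType) (Z : seq (M * N)) u v :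
  same_cut (swap_pairs Z) v u -> same_cut Z u v.
Proof. by move=> uv [a b]; rewrite -mem_swap_pairs => /uv /= ->. Qed.

Lemma compatible_swap (M N : rcfType) (Z : seq (M * N)) :
  compatible Z -> compatible (swap_pairs Z).
Proof. by move=> cZ [b a]; rewrite mem_swap_pairs => /cZ /same_cut_swap. Qed.

Lemma same_cut_convex (M N : rcfType) (Z : seq (M * N)) u v w u' :
  same_cut Z u u' -> same_cut Z w u' -> (u <= v <= w) || (w <= v <= u) ->
  same_cut Z v u'.
Proof.
move=> hu hw huvw z zZ; rewrite -(hu z zZ).
have := hu z zZ; rewrite -(hw z zZ).
case: (sgzP (u - z.1)); case: (sgzP (w - z.1)) => // h1 h2 _.
- apply/eqP; rewrite sgz_eq0; lra.
- apply/eqP; rewrite sgz_cp0; lra.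
- apply/eqP; rewrite sgz_cp0; lra.
Qed.

(** Either list may be empty and then stands for an infinite end; otherwise this is density of the
    order. *)
Lemma strictly_between (N : realFieldType) (l h : seq N) :
  (forall x y, x \in l -> y \in h -> x < y) ->
  exists u, (forall x, x \in l -> x < u) /\ (forall y, y \in h -> u < y).
Proof.
elim: l => [|a l IH] lh.
  elim: h {lh} => [|b h [u [_ uh]]]; first by exists 0.
  exists (Num.min u (b - 1)); split=> // y; rewrite inE => /orP[/eqP->|/uh uy].
    by rewrite gt_min; apply/orP; right; lra.
  by rewrite gt_min uy.
have [x y xl yh|u [ul uh]] := IH; first by apply: lh; rewrite // inE xl orbT.
have [au|ua] := ltP a u.
  by exists u; split=> // x; rewrite inE => /orP[/eqP->|/ul].
suff [w [aw wh]] : exists w, a < w /\ forall y, y \in h -> w < y.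
  exists w; split=> // x; rewrite inE => /orP[/eqP->//|/ul xu].
  exact: lt_trans (lt_le_trans xu ua) aw.
have ah y : y \in h -> a < y by apply: lh; rewrite inE eqxx.
elim: h ah {lh ul uh IH} => [|b h IH] ah; first by exists (a + 1); split=> //; lra.
have [y yh|w [aw wh]] := IH; first by apply: ah; rewrite inE yh orbT.
have ab : a < b by apply: ah; rewrite inE eqxx.
exists (Num.min w ((a + b) / 2)); split; first by rewrite lt_min aw; lra.
move=> y; rewrite inE gt_min => /orP[/eqP->|/wh->//].
by apply/orP; right; lra.
Qed.

(** By [compatible], the partners of the points below [u] lie below the partners of the points above
    [u], which leaves room for [v]. *)
Lemma same_cut_exists (M N : rcfType) (Z : seq (M * N)) (u : M) :
  compatible Z -> exists v, same_cut Z u v.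
Proof.
move=> cZ; case: (boolP (has (fun z => z.1 == u) Z)) => [/hasP[z zZ /eqP<-]|].
  by exists z.2; exact: cZ.
move=> /hasPn nu.
have [|v [lv hv]] := @strictly_between N [seq z.2 | z <- Z & z.1 < u]
    [seq z.2 | z <- Z & u < z.1].
  move=> _ _ /mapP[z + ->] /mapP[w + ->]; rewrite !mem_filter.
  move=> /andP[zu zZ] /andP[uw wZ].
  by rewrite -subr_lt0 -(eq_sgz_lt0 (cZ _ zZ _ wZ)) subr_lt0 (lt_trans zu).
exists v => z zZ; case: (ltgtP u z.1) => uz.
- have /hv : z.2 \in [seq z.2 | z <- Z & u < z.1].
    by apply: map_f; rewrite mem_filter uz.
  by move=> h; rewrite !ltr0_sgz ?subr_lt0.
- have /lv : z.2 \in [seq z.2 | z <- Z & z.1 < u].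
    by apply: map_f; rewrite mem_filter uz.
  by move=> h; rewrite !gtr0_sgz ?subr_gt0.
- by have := nu z zZ; rewrite -uz eqxx.
Qed.

Lemma same_cut_open (M N : rcfType) (Z : seq (M * N)) (u : M) (u' : N) :
  same_cut Z u u' -> (forall z, z \in Z -> z.1 != u) ->
  exists2 v, u < v & forall w, u <= w < v -> same_cut Z w u'.
Proof.
move=> uu' nu.
have [|v [lv hv]] := @strictly_between M [:: u] [seq z.1 | z <- Z & u < z.1].
  move=> x y; rewrite inE => /eqP-> /mapP[z + ->].
  by rewrite mem_filter => /andP[].
exists v; first by apply: lv; rewrite inE.
move=> w /andP[uw wv] z zZ; rewrite -uu' //; case: (ltgtP u z.1) => uz.
- have /hv vz : z.1 \in [seq z.1 | z <- Z & u < z.1].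
    by apply: map_f; rewrite mem_filter uz.
  by rewrite !ltr0_sgz ?subr_lt0 // (lt_trans wv).
- by rewrite !gtr0_sgz ?subr_gt0 // (lt_le_trans uz).
- by have := nu z zZ; rewrite -uz eqxx.
Qed.

(** If [u] were not a point of [Z], its cell would contain an interval to the right of [u], and a
    nonzero polynomial has no root just to the right of [u]. *)
Lemma root_in_cut (M N : rcfType) (Z : seq (M * N)) (p : {poly M}) u u' :
  same_cut Z u u' -> (forall v, same_cut Z v u' -> p.[v] = 0) -> p != 0 ->
  exists2 z, z \in Z & z.1 = u.
Proof.
move=> uu' p0 pn0; apply: contrapT => nu.
have [|v uv hv] := same_cut_open uu'.
  by move=> z zZ; apply/eqP => zu; apply: nu; exists z.
have [w] := neighpr_wit uv pn0.
move=> wn; have := neighpr_root wn; rewrite /root p0 ?eqxx //.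
move: wn; rewrite /neighpr in_itv /= => /andP[uw wv]; apply: hv.
have := next_root_in p u v; rewrite in_itv /= (max_idPl (ltW uv)) => /andP[_ h].
by rewrite ltW // (lt_le_trans wv).
Qed.

Definition sign_agree (M N : rcfType) (Z : seq (M * N))
    (F : seq ({poly M} * {poly N})) :=
  forall u u', same_cut Z u u' -> forall pq, pq \in F -> sgz pq.1.[u] = sgz pq.2.[u'].

(** This clause lets the sign of a new polynomial at a point of [Z] be computed from its remainder
    modulo a member of [F]. *)
Definition rooted (M N : rcfType) (Z : seq (M * N))
    (F : seq ({poly M} * {poly N})) :=
  forall z, z \in Z -> exists2 pq, pq \in F &
    [/\ pq.1 != 0, pq.2 != 0, pq.1.[z.1] = 0 & pq.2.[z.2] = 0].

Definition diagram (M N : rcfType) (Z : seq (M * N))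
    (F : seq ({poly M} * {poly N})) :=
  [/\ compatible Z, sign_agree Z F & rooted Z F].

Lemma sign_agree_swap (M N : rcfType) Z (F : seq ({poly M} * {poly N})) :
  sign_agree Z F -> sign_agree (swap_pairs Z) (swap_pairs F).
Proof.
by move=> h v u /same_cut_swapK /h {}h [q p]; rewrite mem_swap_pairs => /h /= ->.
Qed.

(** On a cell the sign is constant, being that of the partner polynomial at a single point; so a
    root outside [Z] would make the polynomial vanish on an open cell. *)
Lemma sign_agree_root (M N : rcfType) Z (F : seq ({poly M} * {poly N})) pq u :
  compatible Z -> sign_agree Z F -> pq \in F -> pq.1 != 0 -> pq.1.[u] = 0 ->
  exists2 z, z \in Z & z.1 = u.
Proof.
move=> cZ sZ pqF p0 pu0; have [u' uu'] := same_cut_exists u cZ.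
apply: (root_in_cut uu' _ p0) => v vu'; apply/eqP.
by rewrite -sgz_eq0 (sZ _ _ vu' _ pqF) -(sZ _ _ uu' _ pqF) sgz_eq0 pu0.
Qed.

Lemma sign_agree_poly0 (M N : rcfType) Z (F : seq ({poly M} * {poly N})) pq :
  compatible Z -> sign_agree Z F -> pq \in F -> pq.1 = 0 -> pq.2 = 0.
Proof.
move=> cZ sZ pqF p0; apply/eqP; apply: contrapT => /negP q0.
(* A point beyond all of [Z]. There the second polynomial vanishes, agreeing in sign with 0,
   although its roots should be points of [Z]. *)
have [x [x0 nx]] : exists x : N, pq.2.[x] = 0 /\ forall z, z \in swap_pairs Z -> z.1 != x.
  have [x [_ xZ]] := @strictly_between N [::] [seq z.2 | z <- Z] (fun _ _ h => ltac:(by [])).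
  have [x' xx'] := same_cut_exists x (compatible_swap cZ).
  exists x; split.
    apply/eqP; rewrite -sgz_eq0 -(sZ _ _ (same_cut_swapK xx') _ pqF) p0.
    by rewrite horner0 sgz0.
  move=> [b a]; rewrite mem_swap_pairs => ab /=.
  by rewrite gt_eqF // xZ //; apply/mapP; exists (a, b).
have pqF' : (pq.2, pq.1) \in swap_pairs F by rewrite mem_swap_pairs -surjective_pairing.
have [z zZ zx] := sign_agree_root (compatible_swap cZ) (sign_agree_swap sZ) pqF' q0 x0.
by have := nx z zZ; rewrite zx eqxx.
Qed.

(** Dropping points merges cells. If a member of [F0] changed sign inside a merged cell, the
    intermediate value theorem would give a root there; this root is a point of [Z], and it is among
    those that are kept. *)
Lemma diagram_sub (M N : rcfType) Z (F F0 : seq ({poly M} * {poly N})) :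
  diagram Z F -> {subset F0 <= F} -> exists Z0, diagram Z0 F0 /\ {subset Z0 <= Z}.
Proof.
move=> [cZ sZ rZ] F0F.
pose rt (z : M * N) := has (fun pq => [&& pq.1 != 0, pq.2 != 0, root pq.1 z.1
   & root pq.2 z.2]) F0.
exists [seq z <- Z | rt z]; split; last by move=> z; rewrite mem_filter => /andP[].
split.
- move=> z; rewrite mem_filter => /andP[_ zZ] w; rewrite mem_filter => /andP[_ wZ].
  exact: cZ.
- move=> u u' uu' pq pqF0; have pqF := F0F _ pqF0.
  have [w' uw'] := same_cut_exists u cZ.
  rewrite (sZ _ _ uw' _ pqF); apply: contrapT => nsg.
  have q0 : pq.2 != 0 by apply/eqP => q0; apply: nsg; rewrite q0 !horner0.
  have p0 : pq.1 != 0.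
    exact: contra_neq (sign_agree_poly0 cZ sZ pqF) q0.
  have [r' rb qr'] : exists2 r', (w' <= r' <= u') || (u' <= r' <= w') & pq.2.[r'] = 0.
    wlog le : u' w' {uu' uw'} nsg / w' <= u' => [W|].
      case: (leP w' u') => [|/ltW] le; first exact: W.
      have [|r' h qr'] := W w' u' _ le; first by move=> e; apply: nsg.
      by exists r'; rewrite 1?orbC.
    have [|h] := leP (pq.2.[w'] * pq.2.[u']) 0.
      move=> /(polyrcf.poly_ivt le)[r']; rewrite in_itv /= => h /rootP; exists r' => //.
      by rewrite h.
    case: nsg; move: h; rewrite -sgz_gt0 sgzM.
    by case: (sgzP pq.2.[w']); case: (sgzP pq.2.[u']).
  have [r rr'] := same_cut_exists r' (compatible_swap cZ).
  have pr : pq.1.[r] = 0.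
    by apply/eqP; rewrite -sgz_eq0 (sZ _ _ (same_cut_swapK rr') _ pqF) qr' sgz0.
  have [z zZ zr] := sign_agree_root cZ sZ pqF p0 pr.
  have z2 : z.2 = r'.
    have := same_cut_swapK rr' zZ; rewrite zr subrr sgz0 => /esym/eqP.
    by rewrite sgz_eq0 subr_eq0 => /eqP.
  have zZ0 : z \in [seq z <- Z | rt z].
    rewrite mem_filter zZ andbT; apply/hasP; exists pq => //.
    by rewrite p0 q0 /root zr z2 pr qr' !eqxx.
  have := uu' z zZ0; rewrite (uw' z zZ) z2.
  case: sgzP => h1; case: sgzP => h2 // _.
  - by apply: nsg; congr (sgz pq.2.[_]); clear -h1 h2; lra.
  - by clear -rb h1 h2; lra.
  - by clear -rb h1 h2; lra.
- move=> z; rewrite mem_filter => /andP[/hasP[pq pqF0 /and4P[? ? /rootP ? /rootP ?]] _].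
  by exists pq.
Qed.

Lemma seq_max (M : realDomainType) (T : eqType) (h : T -> M) (s : seq T) (P : pred T) :
  has P s -> exists2 x, (x \in s) && P x & forall y, y \in s -> P y -> h y <= h x.
Proof.
elim: s => //= a s IH; have [/IH[x /andP[xs Px] mx] _|ns] := boolP (has P s).
  have [Pa|nPa] := boolP (P a); last first.
    exists x; first by rewrite inE xs orbT.
    by move=> y; rewrite inE => /orP[/eqP->|/mx//]; rewrite (negbTE nPa).
  have [ax|xa] := leP (h a) (h x).
    exists x; first by rewrite inE xs orbT.
    by move=> y; rewrite inE => /orP[/eqP->|/mx].
  exists a; first by rewrite inE eqxx.
  move=> y; rewrite inE => /orP[/eqP->//|/mx yx Py].
  exact: le_trans (yx Py) (ltW xa).
rewrite orbF => Pa; exists a; first by rewrite inE eqxx.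
move=> y; rewrite inE => /orP[/eqP->//|ys Py].
by case/hasP: ns; exists y.
Qed.

(* The left end of the cell of u: either a point of Z, where f and g have the same
   sign, or minus infinity, where the sign comes from the leading coefficient. *)
Lemma cell_left_end (M N : rcfType) (Z : seq (M * N)) (f : {poly M}) (g : {poly N}) u u' :
  compatible Z -> f != 0 -> size f = size g ->
  sgz (lead_coef f) = sgz (lead_coef g) ->
  (forall z, z \in Z -> sgz f.[z.1] = sgz g.[z.2]) ->
  same_cut Z u u' -> (forall z, z \in Z -> z.1 != u) ->
  (forall v, same_cut Z u v -> 0 < g.[v]) ->
  exists v, [/\ v < u, 0 <= f.[v] & forall w, v < w <= u -> same_cut Z w u'].
Proof.
move=> cZ f0 sz lc vZ uu' ou pos.
have [/(seq_max (fun z => z.1))[z0 /andP[z0Z z0u] mx]|/hasPn nu] :=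
    boolP (has (fun z => z.1 < u) Z).
  exists z0.1; split=> //; last first.
    move=> w /andP[zw wu] z zZ; rewrite -uu' //.
    have [uz|zu|uz] := ltgtP u z.1; last by have := ou z zZ; rewrite uz eqxx.
      by rewrite !ltr0_sgz // subr_lt0 // (le_lt_trans wu).
    by rewrite !gtr0_sgz // subr_gt0 // (le_lt_trans (mx _ zZ zu)).
  rewrite -sgz_ge0 vZ // sgz_ge0 leNgt; apply/negP => neg.
  have z0u' : z0.2 < u'.
    by rewrite -subr_gt0 -(eq_sgz_gt0 (uu' _ z0Z)) subr_gt0.
  have [|r] := polyrcf.poly_ivtoo (ltW z0u') (p := g).
    by rewrite nmulr_rlt0 // pos.
  rewrite in_itv /= => /andP[zr ru] /rootP gr.
  suff /pos : same_cut Z u r by rewrite gr ltxx.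
  move=> z zZ; have [uz|zu|uz] := ltgtP u z.1; last by have := ou z zZ; rewrite uz eqxx.
    have : u' < z.2 by rewrite -subr_lt0 -(eq_sgz_lt0 (uu' _ zZ)) subr_lt0.
    by move=> u'z; rewrite !ltr0_sgz // subr_lt0 // (lt_trans ru).
  have zz0 : z.2 <= z0.2.
    have := mx _ zZ zu; rewrite -subr_le0 -sgz_le0 (cZ _ zZ _ z0Z).
    by rewrite sgz_le0 subr_le0.
  by rewrite !gtr0_sgz // subr_gt0 // (le_lt_trans zz0).
have uZ z : z \in Z -> u < z.1.
  by move=> zZ; rewrite lt_neqAle eq_sym ou //= leNgt nu.
have u'Z z : z \in Z -> u' < z.2.
  by move=> zZ; rewrite -subr_lt0 -(eq_sgz_lt0 (uu' _ zZ)) subr_lt0 uZ.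
have g0 : g != 0 by rewrite -size_poly_eq0 -sz size_poly_eq0.
exists (Num.min (u - 1) (- cauchy_bound f)); split.
- by rewrite gt_min; apply/orP; left; lra.
- pose v' := Num.min u' (- cauchy_bound g).
  have uv' : same_cut Z u v'.
    move=> z zZ; rewrite !ltr0_sgz // subr_lt0; last exact: uZ.
    by rewrite gt_min u'Z.
  have := @sgp_minftyP _ _ _ (le_cauchy_bound f0) (Num.min (u - 1) (- cauchy_bound f)).
  rewrite in_itv /= ge_min lexx orbT => /(_ isT) /(congr1 (@sgz M)).
  have := @sgp_minftyP _ _ _ (le_cauchy_bound g0) v'.
  rewrite in_itv /= ge_min lexx orbT => /(_ isT) /(congr1 (@sgz N)).
  rewrite /sgp_minfty !sgz_sgr !sgzM !sgzX !sgzN1 sz lc => <-.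
  by rewrite (gtr0_sgz (pos _ uv')) -sgz_ge0 => ->.
- move=> w /andP[_ wu] z zZ; rewrite !ltr0_sgz // subr_lt0 ?u'Z //.
  exact: le_lt_trans (uZ _ zZ).
Qed.

(** The reflection at 0 exchanges left and right ends. As [f] and [g] have the same size, it changes
    their leading coefficients by the same sign. *)
Lemma cell_right_end (M N : rcfType) (Z : seq (M * N)) (f : {poly M}) (g : {poly N}) u u' :
  compatible Z -> f != 0 -> size f = size g ->
  sgz (lead_coef f) = sgz (lead_coef g) ->
  (forall z, z \in Z -> sgz f.[z.1] = sgz g.[z.2]) ->
  same_cut Z u u' -> (forall z, z \in Z -> z.1 != u) ->
  (forall v, same_cut Z u v -> 0 < g.[v]) ->
  exists v, [/\ u < v, 0 <= f.[v] & forall w, u <= w < v -> same_cut Z w u'].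
Proof.
move=> cZ f0 sz lc vZ uu' ou pos.
pose Z' := [seq (- z.1, - z.2) | z <- Z].
have memZ' a b : ((- a, - b) \in Z') = ((a, b) \in Z).
  rewrite (mem_map _ Z (a, b)) // => -[x1 x2] [y1 y2] [] /oppr_inj /= -> /oppr_inj -> //.
have cutZ' a b : same_cut Z' (- a) (- b) <-> same_cut Z a b.
  split=> h [c d] cd; last first.
    case/mapP: cd => -[x y] xy [-> ->] /=.
    by rewrite -!opprD !sgzN (h _ xy).
  have := h (- c, - d); rewrite memZ' => /(_ cd) /=.
  by rewrite -!opprD !sgzN => /oppr_inj.
have szX (K : idomainType) : (1 < size (- 'X : {poly K}))%N.
  by rewrite size_polyN size_polyX.
have lcX (K : idomainType) (p : {poly K}) :
  lead_coef (p \Po - 'X) = lead_coef p * (-1) ^+ (size p).-1.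
  by rewrite lead_coef_comp // lead_coefN lead_coefX.
have szXp (K : idomainType) (p : {poly K}) : size (p \Po - 'X) = size p.
  by rewrite size_comp_poly2 // size_polyN size_polyX.
have [|||||||v|v [vu fv hv]] := @cell_left_end M N Z' (f \Po - 'X) (g \Po - 'X) (- u) (- u').
- by move=> _ /mapP[z zZ ->] /=; apply/cutZ'; exact: cZ.
- by rewrite -size_poly_eq0 szXp size_poly_eq0.
- by rewrite !szXp.
- by rewrite !lcX !sgzM !sgzX !sgzN1 lc sz.
- by move=> _ /mapP[z zZ ->] /=; rewrite !horner_comp !hornerE !opprK vZ.
- exact/cutZ'.
- by move=> _ /mapP[z zZ ->] /=; rewrite eqr_opp ou.
- rewrite -[v]opprK => /cutZ' /pos.
  by rewrite horner_comp !hornerE opprK.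
exists (- v); split; first by rewrite ltrNr.
  by move: fv; rewrite horner_comp !hornerE.
move=> w /andP[uw wv]; apply/cutZ'/hv.
by rewrite ltrNr wv lerN2.
Qed.

(** The last clause puts the roots of the derivative of [f] among the points of [Z], which makes [f]
    strictly monotone on open cells; the same for [g] follows by sign agreement. *)
Definition matched (M N : rcfType) (Z : seq (M * N)) (f : {poly M}) (g : {poly N}) :=
  [/\ size f = size g, sgz (lead_coef f) = sgz (lead_coef g),
      forall z, z \in Z -> sgz f.[z.1] = sgz g.[z.2],
      forall u u', same_cut Z u u' -> sgz f^`().[u] = sgz g^`().[u'] &
      forall u, (forall z, z \in Z -> z.1 != u) -> f^`().[u] != 0].

(** [f] is nonnegative at both ends [v] and [w] and strictly monotone in between: if increasing, it
    exceeds its value at [v], if decreasing, its value at [w]. *)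
Lemma matched_cell_gt0 (M N : rcfType) (Z : seq (M * N)) (f : {poly M}) (g : {poly N}) u u' :
  compatible Z -> matched Z f g ->
  same_cut Z u u' -> (forall z, z \in Z -> z.1 != u) ->
  (forall v, same_cut Z u v -> 0 < g.[v]) -> 0 < f.[u].
Proof.
move=> cZ [sz lc vZ dZ d0] uu' ou pos.
have f0 : f != 0 by apply: contraNneq (d0 u ou) => ->; rewrite deriv0 horner0.
have [v [vu fv hv]] := cell_left_end cZ f0 sz lc vZ uu' ou pos.
have [w [uw fw hw]] := cell_right_end cZ f0 sz lc vZ uu' ou pos.
have dc c : v < c < w -> sgz f^`().[c] = sgz g^`().[u'].
  move=> /andP[vc cw]; apply: dZ; have [cu|uc] := leP c u.
    by apply: hv; rewrite vc.
  by apply: hw; rewrite ltW.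
have [|c1 c1b e1] := @poly_mvt_neq _ f v u; first by rewrite lt_eqF.
have [|c2 c2b e2] := @poly_mvt_neq _ f w u; first by rewrite gt_eqF.
have := dc c1; have := dc c2; have -> : v < c1 < w.
  by case/orP: c1b => /andP[a b]; apply/andP; split; lra.
have -> : v < c2 < w by case/orP: c2b => /andP[a b]; apply/andP; split; lra.
move=> /(_ isT) h2 /(_ isT) h1.
have := d0 u ou; rewrite -sgz_eq0 (dZ _ _ uu') sgz_eq0 neq_lt => /orP[gn|gp].
  have : f^`().[c2] < 0 by rewrite (eq_sgz_lt0 h2).
  move=> n2; have : f.[w] - f.[u] < 0 by rewrite e2 nmulr_rlt0 // subr_gt0.
  by rewrite subr_lt0; exact: le_lt_trans.
have : 0 < f^`().[c1] by rewrite (eq_sgz_gt0 h1).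
move=> p1; have : f.[v] - f.[u] < 0 by rewrite e1 pmulr_rlt0 // subr_lt0.
by rewrite subr_lt0; exact: le_lt_trans.
Qed.

Lemma open_swap (M N : rcfType) (Z : seq (M * N)) u u' :
  same_cut Z u u' -> (forall z, z \in Z -> z.1 != u) ->
  forall z, z \in swap_pairs Z -> z.1 != u'.
Proof.
move=> uu' ou [b a]; rewrite mem_swap_pairs => ab /=.
apply: contraNneq (ou _ ab) => e; have := uu' _ ab.
by rewrite /= e subrr sgz0 => /eqP; rewrite sgz_eq0 subr_eq0 eq_sym.
Qed.

Lemma matched_swap (M N : rcfType) (Z : seq (M * N)) (f : {poly M}) (g : {poly N}) :
  compatible Z -> matched Z f g -> matched (swap_pairs Z) g f.
Proof.
move=> cZ [sz lc vZ dZ d0]; split=> // [[b a]|u' u /same_cut_swapK /dZ -> //|u' ou'].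
  by rewrite mem_swap_pairs => /vZ.
have [u uu'] := same_cut_exists u' (compatible_swap cZ).
rewrite -(eq_sgz_eq0 (dZ _ _ (same_cut_swapK uu'))) d0 // => -[a b] ab.
by apply: (open_swap uu' ou'); rewrite !mem_swap_pairs.
Qed.

(** Without a zero on the cell [g] has constant sign there, by the intermediate value theorem;
    negating both polynomials reduces to the positive case. *)
Lemma matched_cell_sign (M N : rcfType) (Z : seq (M * N)) (f : {poly M})
    (g : {poly N}) u u' :
  compatible Z -> matched Z f g ->
  same_cut Z u u' -> (forall z, z \in Z -> z.1 != u) ->
  (forall v, same_cut Z u v -> g.[v] != 0) -> sgz f.[u] = sgz g.[u'].
Proof.
move=> cZ; wlog gu : f g / 0 < g.[u'] => [W|] mfg uu' ou nz.
  have [gu|gu|gu] := ltgtP g.[u'] 0; last by have := nz _ uu'; rewrite gu eqxx.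
    apply: oppr_inj; rewrite -!sgzN -!hornerN; apply: W => //.
    - by rewrite hornerN oppr_gt0.
    - case: mfg => sz lc vZ dZ d0; split.
      + by rewrite !size_polyN.
      + by rewrite !lead_coefN !sgzN lc.
      + by move=> z zZ; rewrite !hornerN !sgzN vZ.
      + by move=> v v' vv'; rewrite !derivN !hornerN !sgzN (dZ v v').
      + by move=> v ov; rewrite derivN hornerN oppr_eq0 d0.
    - by move=> v /nz; rewrite hornerN oppr_eq0.
  exact: W.
rewrite (gtr0_sgz gu) gtr0_sgz //; apply: (matched_cell_gt0 cZ mfg uu' ou).
move=> v uv; rewrite ltNge; apply/negP => gv.
have gv0 : g.[v] * g.[u'] <= 0 by rewrite pmulr_lle0.
have [r rb /rootP gr] : exists2 r, (v <= r <= u') || (u' <= r <= v) & root g r.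
  have [vu'|/ltW u'v] := leP v u'.
    have [r] := polyrcf.poly_ivt vu' gv0; rewrite in_itv /= => rb gr.
    by exists r; rewrite ?rb.
  rewrite mulrC in gv0; have [r] := polyrcf.poly_ivt u'v gv0; rewrite in_itv /= => rb gr.
  by exists r; rewrite ?rb ?orbT.
suff /nz : same_cut Z u r by rewrite gr eqxx.
apply: same_cut_swapK.
exact: same_cut_convex (same_cut_swap uv) (same_cut_swap uu') rb.
Qed.

(* On a cell f is strictly monotone, so it has at most one root there, and whether
   it has one can be read off from the signs at the ends of the cell; these agree
   for f and g. The matched roots are then added to Z. *)
Lemma diagram_step (M N : rcfType) (Z : seq (M * N))
    (B : seq ({poly M} * {poly N})) (f : {poly M}) (g : {poly N}) :
  diagram Z B -> (f^`(), g^`()) \in B -> f^`() != 0 ->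
  size f = size g -> sgz (lead_coef f) = sgz (lead_coef g) ->
  (forall z, z \in Z -> sgz f.[z.1] = sgz g.[z.2]) ->
  exists Z', diagram Z' ((f, g) :: B).
Proof.
move=> [cZ sZ rZ] dB d0 sz lc vZ.
have mfg : matched Z f g.
  split=> // [u u' uu'|u ou]; first exact: sZ uu' _ dB.
  apply/negP => /eqP du; have [z zZ zu] := sign_agree_root cZ sZ dB d0 du.
  by have := ou z zZ; rewrite zu eqxx.
have f0 : f != 0 by apply: contraNneq d0 => ->; rewrite deriv0.
have g0 : g != 0 by rewrite -size_poly_eq0 -sz size_poly_eq0.
have rootsP (K : rcfType) (p : {poly K}) x : p != 0 -> (x \in rootsR p) = (p.[x] == 0).
  by move=> p0; rewrite -roots_on_rootsR // /root in_itv.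
pose W := [seq z <- [seq (a, b) | a <- rootsR f, b <- rootsR g] | `[< same_cut Z z.1 z.2 >]].
have memW z : z \in W <-> [/\ f.[z.1] = 0, g.[z.2] = 0 & same_cut Z z.1 z.2].
  rewrite mem_filter; split.
    move=> /andP[/asboolP h /allpairsP[[a b] /= [+ + ez]]].
    by rewrite ez in h *; rewrite !rootsP // => /eqP ? /eqP ?.
  case: z => a b /= [fa gb ab]; apply/andP; split; first exact/asboolP.
  by apply/allpairsP; exists (a, b); rewrite !rootsP // fa gb !eqxx.
(* Monotonicity as a sign formula, from the mean value theorem. It shows both that a cell has at
   most one root and on which side of the root a point lies. *)
have inj (K L : rcfType) (X : seq (K * L)) (p : {poly K}) (q : {poly L}) u v w :
    compatible X -> matched X p q -> same_cut X u w -> same_cut X v w ->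
    (forall z, z \in X -> z.1 != u) -> u != v ->
    sgz (p.[u] - p.[v]) = sgz (q^`().[w]) * sgz (u - v).
  move=> cX mpq uw vw ou uv; have [c cb ->] := poly_mvt_neq p uv.
  rewrite sgzM; case: mpq => _ _ _ dX _; congr (_ * _); apply: dX.
  by apply: (same_cut_convex uw vw); case/orP: cb => /andP[/ltW-> /ltW->]; rewrite ?orbT.
have cWZ z w : z \in W -> w \in Z -> sgz (z.1 - w.1) = sgz (z.2 - w.2).
  by move=> /memW[_ _ h] /h.
exists (W ++ Z); split.
- move=> z zWZ w wWZ; move: zWZ wWZ; rewrite !mem_cat.
  move=> /orP[zW|zZ] /orP[wW|wZ].
  + have /memW[fz gz zz] := zW; have /memW[fw gw ww] := wW.
    have [zw|nzw] := pselect (same_cut Z z.1 w.2).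
      have [/hasP[x xZ /eqP xz]|/hasPn oz] := boolP (has (fun x => x.1 == z.1) Z).
        have x2 y : same_cut Z z.1 y -> y = x.2.
          move=> /(_ x xZ); rewrite xz subrr sgz0 => /esym/eqP.
          by rewrite sgz_eq0 subr_eq0 => /eqP.
        rewrite (x2 _ zz) (x2 _ zw) subrr; have := ww _ xZ.
        rewrite (x2 _ zw) subrr sgz0 => /eqP; rewrite sgz_eq0 subr_eq0 xz => /eqP ->.
        by rewrite subrr !sgz0.
      have [e1|n1] := eqVneq z.1 w.1.
        rewrite e1 subrr sgz0; have [->|n2] := eqVneq z.2 w.2; first by rewrite subrr sgz0.
        have := inj _ _ _ _ _ _ _ _ (compatible_swap cZ) (matched_swap cZ mfg)
          (same_cut_swap zz) (same_cut_swap zw) (open_swap zz oz) n2.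
        rewrite gz gw subrr sgz0 => /esym/eqP; rewrite mulf_eq0 !sgz_eq0 subr_eq0 (negbTE n2).
        by case: mfg => _ _ _ _ /(_ _ oz) /negbTE ->.
      have := inj _ _ _ _ _ _ _ _ cZ mfg zw ww oz n1.
      case: mfg => _ _ _ dZ d0'.
      rewrite fz fw subrr sgz0 => /esym/eqP; rewrite mulf_eq0 !sgz_eq0 subr_eq0 (negbTE n1).
      by rewrite -(eq_sgz_eq0 (dZ _ _ zw)) (negbTE (d0' _ oz)).
    (* The two new points lie in different cells, so some old point [x] separates them, on the side
       of [M] and of [N] alike. *)
    have [x xZ nx] : exists2 x, x \in Z & sgz (z.1 - x.1) <> sgz (w.1 - x.1).
      apply: contrapT => h; apply: nzw => x xZ; rewrite -ww //.
      by apply: contrapT => n; apply: h; exists x.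
    have := zz _ xZ; have := ww _ xZ; move: nx.
    case: (sgzP (z.1 - x.1)) => h1; case: (sgzP (w.1 - x.1)) => h2 // _;
    case: (sgzP (w.2 - x.2)) => h3 // _; case: (sgzP (z.2 - x.2)) => h4 // _.
    * have a1 : z.1 - w.1 < 0 by clear -h1 h2; lra.
      have a2 : z.2 - w.2 < 0 by clear -h3 h4; lra.
      by rewrite !ltr0_sgz.
    * have a1 : 0 < z.1 - w.1 by clear -h1 h2; lra.
      have a2 : 0 < z.2 - w.2 by clear -h3 h4; lra.
      by rewrite !gtr0_sgz.
    * have a1 : 0 < z.1 - w.1 by clear -h1 h2; lra.
      have a2 : 0 < z.2 - w.2 by clear -h3 h4; lra.
      by rewrite !gtr0_sgz.
    * have a1 : 0 < z.1 - w.1 by clear -h1 h2; lra.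
      have a2 : 0 < z.2 - w.2 by clear -h3 h4; lra.
      by rewrite !gtr0_sgz.
    * have a1 : z.1 - w.1 < 0 by clear -h1 h2; lra.
      have a2 : z.2 - w.2 < 0 by clear -h3 h4; lra.
      by rewrite !ltr0_sgz.
    * have a1 : z.1 - w.1 < 0 by clear -h1 h2; lra.
      have a2 : z.2 - w.2 < 0 by clear -h3 h4; lra.
      by rewrite !ltr0_sgz.
  + exact: cWZ.
  + by rewrite -(opprB w.1) -(opprB w.2); apply/eq_sgzN/cWZ.
  + exact: cZ.
- move=> u u' uu'; have uu : same_cut Z u u' by move=> z zZ; rewrite uu' // mem_cat zZ orbT.
  move=> pq; rewrite inE => /orP[/eqP->/=|]; last exact: sZ uu _.
  have [/hasP[x xZ /eqP xu]|/hasPn ou] := boolP (has (fun x => x.1 == u) Z).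
    have := uu x xZ; rewrite xu subrr sgz0 => /esym/eqP; rewrite sgz_eq0 subr_eq0 => /eqP->.
    by rewrite -xu vZ.
  have [[v' [uv' gv']]|n1] := pselect (exists v', same_cut Z u v' /\ g.[v'] = 0); last first.
    apply: (matched_cell_sign cZ mfg uu ou) => v uv; apply/negP => /eqP gv.
    by apply: n1; exists v.
  have [[v [vu' fv]]|n1] := pselect (exists v, same_cut Z v u' /\ f.[v] = 0); last first.
    apply/esym; apply: (matched_cell_sign (compatible_swap cZ) (matched_swap cZ mfg)
       (same_cut_swap uu) (open_swap uu ou)) => v vu; apply/negP => /eqP fv.
    by apply: n1; exists v; split=> //; exact: same_cut_swapK.
  (* Both polynomials have a root in the cell. The roots form a pair in [W], so [u] and [u'] lie on
     the same side of it, and the sign formula applies to both. *)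
  have vv' : same_cut Z v v' by move=> z zZ; rewrite vu' // -uu // uv'.
  have vW : (v, v') \in W ++ Z by rewrite mem_cat; apply/orP; left; apply/memW.
  have := uu' _ vW => /= e.
  have [uv|nuv] := eqVneq u v.
    rewrite uv fv sgz0; move: e; rewrite uv subrr sgz0 => /esym/eqP.
    by rewrite sgz_eq0 subr_eq0 => /eqP->; rewrite gv' sgz0.
  have nuv' : u' != v' by rewrite -subr_eq0 -(eq_sgz_eq0 e) subr_eq0.
  have := inj _ _ _ _ _ _ _ _ cZ mfg uu vu' ou nuv; rewrite fv subr0 => ->.
  have := inj _ _ _ _ _ _ _ _ (compatible_swap cZ) (matched_swap cZ mfg)
     (same_cut_swap uu) (same_cut_swap uv') (open_swap uu ou) nuv'.
  by rewrite gv' subr0 e => ->; congr (_ * _); case: mfg => _ _ _ /(_ _ _ uu) ->.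
- move=> z; rewrite mem_cat => /orP[/memW[fz gz _]|/rZ[pq pqB h]].
    by exists (f, g); rewrite ?inE ?eqxx.
  by exists pq; rewrite // inE pqB orbT.
Qed.

(** * Elimination of one variable *)

(* The extra power of the leading coefficient makes the total multiplier of f a
   square, so that f and prem f g have the same sign at the roots of g. *)
Definition prem (A : idomainType) (f g : {poly A}) : {poly A} :=
  lead_coef g ^+ scalp f g *: (f %% g).

Lemma prem_sgz (A : idomainType) (M : rcfType) (phi : {rmorphism A -> M})
    (f g : {poly A}) (x : M) :
  phi (lead_coef g) != 0 -> (map_poly phi g).[x] = 0 ->
  sgz (map_poly phi f).[x] = sgz (map_poly phi (prem f g)).[x].
Proof.
move=> lg gx; have := Pdiv.Idomain.divp_eq f g.
move=> /(congr1 (fun h => (map_poly phi (lead_coef g ^+ scalp f g *: h)).[x])).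
rewrite scalerDr rmorphD /= -/(prem f g) hornerD => e.
have {e} : (phi (lead_coef g) ^+ scalp f g) ^+ 2 * (map_poly phi f).[x] =
    (map_poly phi (prem f g)).[x].
  move: e; rewrite !map_polyZ !hornerZ /= rmorphM hornerM /= gx !mulr0 add0r.
  by rewrite rmorphXn /= expr2 mulrA.
move=> <-; rewrite sgzM (@gtr0_sgz _ (_ ^+ 2)) ?mul1r //.
by rewrite exprn_even_gt0 //= expf_neq0.
Qed.

(** Quantifier elimination without formulas: the signs of the elements of [G] decide the whole sign
    diagram of [F], uniformly in both fields and both specializations. *)
Definition transfers (A : idomainType) (G : seq A) (F : seq {poly A}) :=
  forall (M N : rcfType) (phi : {rmorphism A -> M}) (psi : {rmorphism A -> N}),
    (forall g, g \in G -> sgz (phi g) = sgz (psi g)) ->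
    exists Z, diagram Z [seq (map_poly phi p, map_poly psi p) | p <- F].

Lemma size_prem (A : idomainType) (f g : {poly A}) :
  g != 0 -> (size (prem f g) < size g)%N.
Proof.
by move=> g0; apply: leq_ltn_trans (size_scale_leq _ _) _; rewrite ltn_modp.
Qed.

Lemma size_map_poly_eq (A : idomainType) (M N : rcfType) (phi : {rmorphism A -> M})
    (psi : {rmorphism A -> N}) (g : {poly A}) :
  (forall i, (phi g`_i == 0) = (psi g`_i == 0)) ->
  size (map_poly phi g) = size (map_poly psi g).
Proof.
move=> h; apply/eqP; rewrite eqn_leq; apply/andP; split; apply/leq_sizeP => j.
  by move=> /leq_sizeP/(_ j (leqnn j))/eqP; rewrite !coef_map => hj; apply/eqP; rewrite h.
by move=> /leq_sizeP/(_ j (leqnn j))/eqP; rewrite !coef_map => hj; apply/eqP; rewrite -h.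
Qed.

(* If the coefficient of degree d of f vanishes, f may be replaced by its
   truncation; otherwise the sign of f at a root of g is that of a remainder. Here
   g is replaced by its truncation at its actual degree after specialization,
   which is why H contains the remainders by all truncations of g. *)
Lemma transfers_cons (A : idomainType) (d : nat) (f : {poly A}) (F H : seq {poly A})
    (G0 : seq A) :
  (size f <= d.+1)%N -> (forall g, g \in F -> (size g <= d.+1)%N) ->
  take_poly d f \in H -> f^`() \in H ->
  (forall g k, g \in f^`() :: F -> (k <= d.+1)%N -> take_poly k g != 0 ->
     prem f (take_poly k g) \in H) ->
  transfers G0 (F ++ H) ->
  transfers (f`_d :: flatten [seq polyseq g | g <- f^`() :: F] ++ G0) (f :: F).
Proof.
move=> sf sF tH dH pH tG M N phi psi sg.
have [|Z dZ] := tG M N phi psi.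
  by move=> g gG; apply: sg; rewrite inE mem_cat gG !orbT.
have sd : sgz (phi f`_d) = sgz (psi f`_d) by apply: sg; rewrite inE eqxx.
have [fd0|fdn0] := eqVneq (phi f`_d) 0.
  have := sd; rewrite fd0 sgz0 => /esym/eqP; rewrite sgz_eq0 => /eqP gd0.
  have mt (K : rcfType) (chi : {rmorphism A -> K}) :
      chi f`_d = 0 -> map_poly chi f = map_poly chi (take_poly d f).
    move=> h; apply/polyP => i; rewrite !coef_map coef_take_poly.
    have [//|di|->] := ltngtP i d; last by rewrite raddf0; exact: h.
    by rewrite nth_default // (leq_trans sf).
  have [|Z0 [dZ0 _]] := diagram_sub dZ (F0 := [seq (map_poly phi p, map_poly psi p) | p <- f :: F]).
    move=> _ /mapP[p + ->]; rewrite inE => /orP[/eqP->|pF].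
      rewrite (mt _ _ fd0) (mt _ _ gd0); apply: (map_f (fun p => (map_poly phi p, map_poly psi p))).
      by rewrite mem_cat tH orbT.
    by apply: (map_f (fun p => (map_poly phi p, map_poly psi p))); rewrite mem_cat pF.
  by exists Z0.
have gdn0 : psi f`_d != 0 by rewrite -(eq_sgz_eq0 sd).
have szf : size f = d.+1.
  apply/eqP; rewrite eqn_leq sf ltnNge; apply: contra fdn0 => h.
  by rewrite nth_default ?rmorph0.
have lcf : lead_coef f = f`_d by rewrite lead_coefE szf.
have szm (K : rcfType) (chi : {rmorphism A -> K}) :
    chi f`_d != 0 -> size (map_poly chi f) = d.+1 /\ lead_coef (map_poly chi f) = chi f`_d.
  by move=> h; rewrite size_map_poly_id0 ?lead_coef_map_eq lcf.
have [spf lpf] := szm _ _ fdn0; have [sqf lqf] := szm _ _ gdn0.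
(* In degree 0 the derivative vanishes and [diagram_step] does not apply, but a nonzero constant
   adds no point to the diagram. *)
case: d => [|d] in sf sF tH pH sg sd fdn0 gdn0 szf lcf spf lpf sqf lqf {szm} *.
  have fC : f = (f`_0)%:P by apply: size1_polyC; rewrite szf.
  have [Z0|Z0 [[cZ0 sZ0 rZ0] _]] := diagram_sub dZ
      (F0 := [seq (map_poly phi p, map_poly psi p) | p <- F]).
    move=> /mapP[p pF ->].
    by apply: (map_f (fun p => (map_poly phi p, map_poly psi p))); rewrite mem_cat pF.
  exists Z0; split=> //.
    move=> u u' uu' pq; rewrite inE => /orP[/eqP->|]; last exact: sZ0.
    by rewrite /= fC !map_polyC /= !hornerC.
  by move=> z /rZ0[pq pF h]; exists pq; rewrite // inE pF orbT.
pose B := f^`() :: F.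
have [|Z1 [dZ1 Z1Z]] := diagram_sub dZ (F0 := [seq (map_poly phi p, map_poly psi p) | p <- B]).
  move=> _ /mapP[p pB ->].
  apply: (map_f (fun p => (map_poly phi p, map_poly psi p))).
  by move: pB; rewrite mem_cat inE => /orP[/eqP->|->//]; rewrite dH orbT.
have [||||z zZ1|Z2 dZ2] := diagram_step dZ1 (f := map_poly phi f) (g := map_poly psi f).
- by rewrite !deriv_map map_f // inE eqxx.
- apply/eqP => /(congr1 (fun p : {poly M} => p`_d)) /eqP.
  by rewrite coef_deriv coef0 mulrn_eq0 /= -[d.+1]/(d.+2.-1) -spf -lead_coefE lpf (negbTE fdn0).
- by rewrite spf sqf.
- by rewrite lpf lqf.
- case: dZ1 => _ sZ1 /(_ _ zZ1)[_ /mapP[g gB ->] /= [p0 q0 pz qz]].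
  have szg : (size g <= d.+2)%N.
    move: gB; rewrite inE => /orP[/eqP->|/sF//].
    by apply: leq_trans sf; rewrite ltnW // lt_size_deriv // -size_poly_eq0 szf.
  (* The signs of all coefficients of [g] are prescribed, so [g] keeps or loses the same top terms
     under both specializations. *)
  have sgi i : sgz (phi g`_i) = sgz (psi g`_i).
    have [gi|ig] := leqP (size g) i; first by rewrite nth_default // !rmorph0 !sgz0.
    apply: sg; rewrite inE mem_cat; apply/orP; right; apply/orP; left.
    by apply/flattenP; exists (polyseq g); [exact: map_f | exact: mem_nth].
  have := size_map_poly_eq (fun i => eq_sgz_eq0 (sgi i)).
  set k := size (map_poly phi g) => szk; pose gk := take_poly k g.
  have mk (K : rcfType) (chi : {rmorphism A -> K}) :
      size (map_poly chi g) = k -> map_poly chi g = map_poly chi gk.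
    move=> h; apply/polyP => i; rewrite [RHS]coef_map coef_take_poly.
    have [//|ki] := ltnP i k; first by rewrite coef_map.
    by rewrite raddf0 nth_default ?h.
  have k0 : (0 < k)%N by rewrite /k size_poly_gt0.
  have gkk : gk`_k.-1 = g`_k.-1 by rewrite coef_take_poly prednK ?leqnn.
  have lck : phi g`_k.-1 != 0.
    by rewrite -coef_map -lead_coefE lead_coef_eq0.
  have szgk : size gk = k.
    apply/eqP; rewrite eqn_leq size_take_poly /= -(prednK k0) ltnNge.
    apply: contra lck => h; rewrite -gkk nth_default ?rmorph0 //.
  have lcgk : lead_coef gk = g`_k.-1 by rewrite lead_coefE szgk gkk.
  rewrite (prem_sgz f (g := gk) (x := z.1)) ?lcgk //; last by rewrite -mk.
  have lck' : psi g`_k.-1 != 0 by rewrite -(eq_sgz_eq0 (sgi _)).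
  rewrite (prem_sgz f (g := gk) (x := z.2)) ?lcgk //; last by rewrite -mk.
  case: dZ => cZ sZ _; have zZ : z \in Z by exact: Z1Z.
  apply: (sZ _ _ (cZ _ zZ) (map_poly phi (prem f gk), map_poly psi (prem f gk))).
  apply: (map_f (fun p => (map_poly phi p, map_poly psi p))); rewrite mem_cat.
  rewrite pH ?orbT //; last by rewrite -size_poly_eq0 szgk -lt0n.
  by apply: leq_trans szg; exact: size_poly.
have [|Z3 [dZ3 _]] := diagram_sub dZ2 (F0 := [seq (map_poly phi p, map_poly psi p) | p <- f :: F]).
  by move=> pq; rewrite /= !inE => /orP[->//|->]; rewrite !orbT.
by exists Z3.
Qed.

(** Double induction: on a bound for the sizes, and on the number of polynomials in [F1] that may
    attain it. Removing one of these adds only its truncation, its derivative and remainders, all of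
    which fall below the bound and go to [F2]. *)
Lemma elimination (A : idomainType) (F : seq {poly A}) : exists G, transfers G F.
Proof.
suff main d : forall F' : seq {poly A},
    (forall f, f \in F' -> (size f <= d)%N) -> exists G, transfers G F'.
  by apply: (main (\max_(f <- F) size f)%N) => f fF; exact/leq_bigmax_seq.
elim: d => [|d IHd] F'.
  move=> F0; exists [::] => M N phi psi _; exists [::]; split=> //.
  move=> u u' _ _ /mapP[f /F0 + ->]; rewrite leqn0 size_poly_eq0 => /eqP-> /=.
  by rewrite !rmorph0 !horner0 !sgz0.
suff step (F1 F2 : seq {poly A}) :
    (forall f, f \in F1 -> (size f <= d.+1)%N) ->
    (forall f, f \in F2 -> (size f <= d)%N) -> exists G, transfers G (F1 ++ F2).
  by move=> sF'; rewrite -[F']cats0; apply: step.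
elim: F1 F2 => [|f F1 IHF] F2 sF1 sF2; first exact: IHd.
have sf : (size f <= d.+1)%N by apply: sF1; rewrite inE eqxx.
pose D := f^`() :: (F1 ++ F2).
pose T := [seq take_poly k g | g <- D, k <- iota 0 d.+2].
pose H := take_poly d f :: f^`() :: [seq prem f h | h <- T & h != 0].
have sD g : g \in D -> (size g <= d.+1)%N.
  rewrite inE => /orP[/eqP->|].
    have [->|f0] := eqVneq f 0; first by rewrite deriv0 size_poly0.
    by apply: leq_trans sf; rewrite ltnW // lt_size_deriv.
  rewrite mem_cat => /orP[gF|/sF2/leqW//]; apply: sF1.
  by rewrite inE gF orbT.
have [g gF|g|G0 tG] := IHF (F2 ++ H).
- by apply: sF1; rewrite inE gF orbT.
- rewrite mem_cat => /orP[/sF2//|]; rewrite !inE => /or3P[/eqP->|/eqP->|].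
  + exact: size_take_poly.
  + have [->|f0] := eqVneq f 0; first by rewrite deriv0 size_poly0.
    by rewrite -ltnS (leq_trans _ sf) // lt_size_deriv.
  + move=> /mapP[h]; rewrite mem_filter => /andP[h0 /allpairsP[[g' k] /= [gD _ eh]]] ->.
    rewrite -ltnS (leq_trans (size_prem _ h0)) //.
    apply: leq_trans (sD _ gD); rewrite eh; apply/leq_sizeP => j sj.
    by rewrite coef_take_poly nth_default // if_same.
exists (f`_d :: flatten [seq polyseq g | g <- D] ++ G0) => /=.
apply: (@transfers_cons _ d f (F1 ++ F2) H) => //.
- by move=> g gF; apply: sD; rewrite inE gF orbT.
- by rewrite inE eqxx.
- by rewrite !inE eqxx orbT.
- move=> g k gD kd tk0; rewrite !inE; apply/or3P; apply: Or33.
  apply: map_f; rewrite mem_filter tk0 /=; apply/allpairsP; exists (g, k).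
  by rewrite mem_iota ltnS kd.
- by rewrite -catA.
Qed.

(** * Transfer of sign conditions in several variables *)

Lemma mmap_muni (R S : comNzRingType) (n : nat) (phi : {rmorphism R -> S})
    (v : 'I_n.+1 -> S) (f : {mpoly R[n.+1]}) :
  mmap phi v f =
  (map_poly (mmap phi (fun i => v (widen_ord (leqnSn n) i))) (muni f)).[v ord_max].
Proof.
rewrite muniE rmorph_sum /= horner_sum; apply: eq_bigr => m _.
rewrite map_polyZ hornerZ map_polyXn hornerXn /= mmapZ mmapX -mulrA; congr (_ * _).
rewrite /mmap1 big_ord_recr; congr (_ * _).
by apply: eq_bigr => i _; rewrite mnmE.
Qed.

(** In a real closed field the positive elements are nonzero squares, and these are preserved by any
    morphism. *)
Lemma sgz_rmorph (R L : rcfType) (phi : {rmorphism R -> L}) (c : R) :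
  sgz (phi c) = sgz c.
Proof.
have pos x : 0 < x -> sgz (phi x) = 1.
  move=> x0; rewrite -(sqr_sqrtr (ltW x0)) rmorphXn; apply/eqP; rewrite sgz_cp0.
  by rewrite exprn_even_gt0 //= fmorph_eq0 sqrtr_eq0 -ltNge.
have [c0|c0|->] := ltgtP c 0; last by rewrite rmorph0 !sgz0.
  by rewrite (ltr0_sgz c0) -[c]opprK rmorphN sgzN pos // oppr_gt0.
by rewrite pos // gtr0_sgz.
Qed.

(** The induction hypothesis is applied to the coefficients [G] that control the last variable; a
    partner of the last coordinate in the resulting diagram completes the point. *)
Lemma mpoly_transfer (R L : rcfType) (phi : {rmorphism R -> L}) (n : nat)
    (F : seq {mpoly R[n]}) (v : 'I_n -> L) :
  exists a : 'I_n -> R, forall f, f \in F -> sgz f.@[a] = sgz (mmap phi v f).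
Proof.
elim: n F v => [|n IHn] F v.
  exists (fun=> 0) => f _; rewrite [f]nvar0_mpolyC mevalC mmapC.
  by rewrite sgz_rmorph.
have [G tG] := elimination [seq muni f | f <- F].
pose w i := v (widen_ord (leqnSn n) i).
have [a aG] := IHn G w.
have [|Z [cZ sZ _]] := tG R L (mmap idfun a) (mmap phi w).
  by move=> g gG; exact: aG.
have [u uv] := same_cut_exists (v ord_max) (compatible_swap cZ).
pose b (i : 'I_n.+1) := oapp a u (unlift ord_max i).
exists b => f fF; rewrite /meval !mmap_muni.
have bw : (fun i => b (widen_ord (leqnSn n) i)) =1 a.
  move=> i; rewrite /b; have -> : widen_ord (leqnSn n) i = lift ord_max i.
    by apply: val_inj; rewrite /= /bump leqNgt ltn_ord.
  by rewrite liftK.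
have -> : b ord_max = u by rewrite /b unlift_none.
rewrite (funext bw).
apply: (sZ _ _ (same_cut_swapK uv)
  (map_poly (mmap idfun a) (muni f), map_poly (mmap phi w) (muni f))).
by apply/mapP; exists (muni f) => //; exact: map_f.
Qed.

(** * Real closure of a precone in an algebraically closed field *)

(* After reducing the squared polynomials modulo p, the quotient by p has smaller
   degree than p and also changes sign between a and b. *)
Lemma sign_change_ndvdp (L : realFieldType) (p : {poly L}) (a b : L)
    (s : seq (L * {poly L})) :
  p.[a] * p.[b] < 0 -> (forall c, c \in s -> 0 <= c.1) ->
  ~~ (p %| 1 + \sum_(c <- s) c.1 *: c.2 ^+ 2).
Proof.
elim: {p}(size p) {-2}p (leqnn (size p)) s => [|n IHn] p sp s pab s0.
  by move: sp pab; rewrite leqn0 size_poly_eq0 => /eqP->; rewrite !horner0 mulr0 ltxx.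
apply/negP => dv; pose s' := [seq (c.1, c.2 %% p) | c <- s].
pose S' := 1 + \sum_(c <- s') c.1 *: c.2 ^+ 2.
have p0 : p != 0 by apply: contraTneq pab => ->; rewrite !horner0 mulr0 ltxx.
have dv' : p %| S'.
  have -> : S' = (1 + \sum_(c <- s) c.1 *: c.2 ^+ 2)
      - \sum_(c <- s) c.1 *: (c.2 ^+ 2 - (c.2 %% p) ^+ 2).
    rewrite /S' big_map -addrA -sumrB; congr (_ + _); apply: eq_bigr => c _.
    by rewrite scalerBr opprB addrC subrK.
  apply: dvdp_sub => //.
  apply: (big_ind (fun q => p %| q)) => [|q r|c _]; [exact: dvdp0|exact: dvdp_add|].
  by rewrite subr_sqr {1}(divp_eq c.2 p) addrK -mul_polyC dvdp_mull // dvdp_mulr // dvdp_mull.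
have s'0 c : c \in s' -> 0 <= c.1 by move=> /mapP[d ds ->]; exact: (s0 _ ds).
have S'_ge1 x : 0 < S'.[x].
  rewrite hornerD hornerC horner_sum ltr_wpDr // big_seq sumr_ge0 // => c cs.
  by rewrite hornerZ horner_exp mulr_ge0 ?s'0 // sqr_ge0.
have /dvdpP[q eq] := dv'.
have qab : q.[a] * q.[b] < 0.
  have := S'_ge1 a; have := S'_ge1 b; rewrite eq !hornerM => hb ha.
  by have := mulr_gt0 ha hb; rewrite mulrACA nmulr_lgt0.
have q0 : q != 0 by apply: contraTneq qab => ->; rewrite !horner0 mulr0 ltxx.
have sz1 : (1 < size p)%N.
  rewrite ltnNge; apply: contraTN pab => /size1_polyC ->.
  by rewrite !hornerC -leNgt -expr2 sqr_ge0.
suff sq : (size q <= n)%N.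
  by have := IHn q sq s' qab s'0; rewrite -/S' eq dvdp_mulr.
have : (size S' <= (size p).-1 + (size p).-2)%N.
  rewrite /S' (leq_trans (size_polyD _ _)) // geq_max size_poly1; apply/andP; split.
    by case: (size p) sz1 => [|[|k]] //=.
  rewrite (leq_trans (size_sum _ _ _)) //; apply/bigmax_leqP_seq => c cs' _.
  rewrite (leq_trans (size_scale_leq _ _)) //.
  have [d ds ->] := mapP cs'; rewrite /= expr2.
  rewrite (leq_trans (size_polyMleq _ _)) //.
  have := ltn_modpN0 d.2 p0; case: (size p) sz1 => [|[|k]] //= _.
  rewrite ltnS => h; rewrite -ltnS; case: (size _) h => [|j] //= jk.
  by rewrite addSn addnS /= !ltnS leq_add.
rewrite eq size_mul //; case: (size p) sz1 sp => [|[|k]] //= _ kn.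
rewrite addnS /= [X in (_ <= X)%N]addnC leq_add2r.
by move=> h; rewrite (leq_trans h) // ltnW.
Qed.

(** Only squares of differences are required: the ambient field will be algebraically closed, where
    -1 is itself a square. *)
Record precone (C : fieldType) (P : C -> Prop) : Prop := Precone {
  precone1 : P 1;
  preconeD : forall x y, P x -> P y -> P (x + y);
  preconeM : forall x y, P x -> P y -> P (x * y);
  preconeV : forall x, P x -> P x^-1;
  precone_sqr : forall x y, P x -> P y -> P ((x - y) ^+ 2);
  preconeN1 : ~ P (-1) }.

Record max_cone (C : fieldType) := MaxCone {
  max_cone_pred :> C -> Prop;
  max_cone_precone : precone max_cone_pred;
  max_cone_max : forall Q, precone Q -> (forall x, max_cone_pred x -> Q x) ->
    forall x, Q x -> max_cone_pred x }.

Lemma max_cone_exists (C : fieldType) (P0 : C -> Prop) : precone P0 ->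
  exists P : max_cone C, forall x, P0 x -> P x.
Proof.
move=> pP0; pose T := {P : C -> Prop | precone P /\ forall x, P0 x -> P x}.
pose R (s t : T) := `[< forall x, sval s x -> sval t x >].
have t0 : T by exists P0; split.
have [||A totA|t tmax] := @classical_sets.ZL_preorder T t0 R.
- by move=> t; apply/asboolP.
- by move=> r s t /asboolP rs /asboolP st; apply/asboolP => x /rs /st.
- have [[s As]|nA] := pselect (exists s, A s); last first.
    by exists t0 => s As; case: nA; exists s.
  have join u v x y : A u -> A v -> sval u x -> sval v y ->
      exists w, [/\ A w, sval w x & sval w y].
    move=> Au Av ux vy; have [/asboolP h|/asboolP h] := totA _ _ Au Av.
      by exists v; split=> //; exact: h.
    by exists u; split=> //; exact: h.
  pose U x := exists2 u, A u & sval u x.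
  have pU : precone U /\ forall x, P0 x -> U x.
    split; last by move=> x px; exists s => //; case: (svalP s) => _; apply.
    split.
    + by exists s => //; case: (svalP s) => [[]].
    + move=> x y [u Au ux] [v Av vy]; have [w [Aw wx wy]] := join u v x y Au Av ux vy.
      by exists w => //; case: (svalP w) => pw _; exact: (preconeD pw).
    + move=> x y [u Au ux] [v Av vy]; have [w [Aw wx wy]] := join u v x y Au Av ux vy.
      by exists w => //; case: (svalP w) => pw _; exact: (preconeM pw).
    + by move=> x [u Au ux]; exists u => //; case: (svalP u) => pw _; exact: (preconeV pw).
    + move=> x y [u Au ux] [v Av vy]; have [w [Aw wx wy]] := join u v x y Au Av ux vy.
      by exists w => //; case: (svalP w) => pw _; exact: (precone_sqr pw).
    + by move=> [u Au ux]; case: (svalP u) => pw _; exact: (preconeN1 pw).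
  exists (exist _ U pU) => u Au; apply/asboolP => x ux /=; by exists u.
have [pt P0t] := svalP t.
have mt Q : precone Q -> (forall x, sval t x -> Q x) -> forall x, Q x -> sval t x.
  move=> pQ tQ; have hQ : precone Q /\ forall x, P0 x -> Q x by split=> // x /P0t /tQ.
  have /asboolP := tmax (exist _ Q hQ) (introT (asboolP _) tQ); exact.
by exists (MaxCone pt mt).
Qed.

Section MaxConeTheory.
Variables (C : fieldType) (P : max_cone C).
Let pP := max_cone_precone P.
Let pD := preconeD pP.
Let pM := preconeM pP.
Let pV := preconeV pP.
Let pS := precone_sqr pP.

Lemma max_cone0 : P 0.
Proof.
by have := precone_sqr pP (precone1 pP) (precone1 pP); rewrite subrr expr0n.
Qed.

Lemma max_cone_two_neq0 : (2 : C) != 0.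
Proof.
apply/eqP => e; apply: (preconeN1 pP).
have -> : (-1 : C) = 1 by apply/eqP; rewrite -subr_eq0 -opprD oppr_eq0 -[1 + 1]/(2 : C) e.
exact: precone1 pP.
Qed.

(** If [x - y] is not in [P], then P - (x - y) P is again a precone, so it equals [P] by maximality.
    Indeed -1 = a - (x - y) b would give x - y = (1 + a) / b. *)
Lemma max_cone_total x y : P x -> P y -> P (x - y) \/ P (y - x).
Proof.
move=> px py; have [|npu] := pselect (P (x - y)); [by left|right].
pose Q z := exists a b, [/\ P a, P b & z = a - (x - y) * b].
have QP z : P z -> Q z by move=> pz; exists z, 0; split; rewrite ?mulr0 ?subr0 //; exact: max_cone0.
have Qsplit z : Q z -> exists a b, [/\ P a, P b & z = a - b].
  move=> [a [b [pa pb ->]]]; exists (a + y * b), (x * b).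
  by split; [apply: (pD) => //; exact: pM | exact: pM | ring].
have Qsqr z : Q z -> P (z ^+ 2).
  by move=> /Qsplit[a [b [pa pb ->]]]; exact: pS.
apply: (max_cone_max (Q := Q)) => //; last first.
  by exists 0, 1; split; [exact: max_cone0|exact: (precone1 pP)|ring].
split.
- exact: QP (precone1 pP).
- move=> _ _ [a [b [pa pb ->]]] [c [d [pc pd ->]]]; exists (a + c), (b + d).
  by split; [exact: pD|exact: pD|ring].
- move=> _ _ [a [b [pa pb ->]]] [c [d [pc pd ->]]].
  exists (a * c + (x - y) ^+ 2 * (b * d)), (a * d + b * c).
  split; [|by apply: pD; exact: pM|ring].
  by apply: (pD); apply: (pM) => //; [exact: pS|exact: pM].
- move=> z Qz; have [->|z0] := eqVneq z 0; first by rewrite invr0; exact/QP/max_cone0.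
  have pz := pV (Qsqr _ Qz); case: Qz z0 pz => a [b [pa pb ez]] z0 pz.
  exists (a * (z ^+ 2)^-1), (b * (z ^+ 2)^-1).
  split; [exact: pM|exact: pM|].
  have -> : a * (z ^+ 2)^-1 - (x - y) * (b * (z ^+ 2)^-1) = z * (z ^+ 2)^-1.
    by move: (z ^+ 2)^-1 => w; rewrite ez; ring.
  by rewrite expr2 invfM mulrA divff // mul1r.
- move=> z w /Qsplit[a [b [pa pb ->]]] /Qsplit[c [d [pc pd ->]]]; apply: QP.
  have -> : a - b - (c - d) = (a + d) - (b + c) by ring.
  by apply: pS => //; exact: pD.
- move=> [a [b [pa pb e]]]; apply: npu.
  have {}e : (x - y) * b = 1 + a by rewrite -[1]opprK e; ring.
  have b0 : b != 0.
    apply/eqP => b0; apply: (preconeN1 pP).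
    have -> : -1 = a by apply/eqP; rewrite eq_sym -subr_eq0 opprK addrC -e b0 mulr0.
    exact: pa.
  have -> : x - y = (1 + a) * b^-1 by rewrite -e mulfK.
  by apply: (pM); [apply: (pD) => //; exact: (precone1 pP)|exact: pV].
Qed.

Lemma max_cone_anti x : P x -> P (- x) -> x = 0.
Proof.
move=> px pnx; apply/eqP; apply: contrapT => /negP x0; apply: (preconeN1 pP).
have -> : -1 = - x * x^-1 by rewrite mulNr divff.
by apply: (pM) => //; exact: pV.
Qed.

(** By totality these are exactly the differences of elements of [P], which is why they form a
    subfield. *)
Definition cone_mem : pred C := fun x => `[< P x \/ P (- x) >].

Lemma cone_memP x : x \in cone_mem <-> P x \/ P (- x).
Proof. by split => h; apply/asboolP. Qed.

Lemma cone_mem_divring : divring_closed cone_mem.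
Proof.
split.
- by apply/cone_memP; left; exact: (precone1 pP).
- move=> x y /cone_memP[px|px] /cone_memP[py|py]; apply/cone_memP; rewrite opprB.
  + exact: max_cone_total.
  + by left; exact: pD.
  + by right; rewrite addrC; apply: (pD) => //.
  + have := max_cone_total py px; by rewrite !opprK ![- _ + _]addrC.
- move=> x y /cone_memP[px|px] /cone_memP[py|py]; apply/cone_memP.
  + by left; apply: pM => //; exact: pV.
  + by right; rewrite -mulrN -invrN; apply: pM => //; exact: pV.
  + by right; rewrite -mulNr; apply: pM => //; exact: pV.
  + by left; rewrite -mulrNN -invrN; apply: pM => //; exact: pV.
Qed.

HB.instance Definition _ := GRing.isDivringClosed.Build C cone_mem cone_mem_divring.

Record cone_field := ConeField { cone_val : C; cone_valP : cone_val \in cone_mem }.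

HB.instance Definition _ := [isSub for cone_val].
HB.instance Definition _ := [Choice of cone_field by <:].
HB.instance Definition _ := [SubChoice_isSubIntegralDomain of cone_field by <:].
HB.instance Definition _ := [SubIntegralDomain_isSubField of cone_field by <:].

Definition cone_le (x y : cone_field) : bool := `[< P (cone_val y - cone_val x) >].
Definition cone_norm (x : cone_field) : cone_field := if cone_le 0 x then x else - x.

Lemma cone_le0 x : cone_le 0 x = `[< P (cone_val x) >].
Proof. by rewrite /cone_le -[cone_val 0]/(val (0 : cone_field)) rmorph0 subr0. Qed.

Lemma cone_valD (x y : cone_field) : cone_val (x + y) = cone_val x + cone_val y.
Proof. exact: (rmorphD (val : cone_field -> C)). Qed.

Lemma cone_valM (x y : cone_field) : cone_val (x * y) = cone_val x * cone_val y.
Proof. exact: (rmorphM (val : cone_field -> C)). Qed.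

Lemma cone_valN (x : cone_field) : cone_val (- x) = - cone_val x.
Proof. exact: (rmorphN (val : cone_field -> C)). Qed.

Lemma cone_val0 : cone_val 0 = 0.
Proof. exact: (rmorph0 (val : cone_field -> C)). Qed.

Fact cone_le0_add x y : cone_le 0 x -> cone_le 0 y -> cone_le 0 (x + y).
Proof. by rewrite !cone_le0 cone_valD => /asboolP ? /asboolP ?; apply/asboolP/pD. Qed.

Fact cone_le0_mul x y : cone_le 0 x -> cone_le 0 y -> cone_le 0 (x * y).
Proof. by rewrite !cone_le0 cone_valM => /asboolP ? /asboolP ?; apply/asboolP/pM. Qed.

Fact cone_le0_anti x : cone_le 0 x -> cone_le x 0 -> x = 0.
Proof.
rewrite cone_le0 /cone_le cone_val0 sub0r => /asboolP px /asboolP pnx.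
by apply: val_inj; rewrite rmorph0; exact: max_cone_anti.
Qed.

Fact cone_sub_ge0 x y : cone_le 0 (y - x) = cone_le x y.
Proof. by rewrite cone_le0 cone_valD cone_valN. Qed.

Fact cone_le0_total x : cone_le 0 x || cone_le x 0.
Proof.
rewrite cone_le0 /cone_le cone_val0 sub0r; apply/orP.
by have /cone_memP[px|px] := cone_valP x; [left|right]; apply/asboolP.
Qed.

Fact cone_normN x : cone_norm (- x) = cone_norm x.
Proof.
rewrite /cone_norm opprK; have -> : cone_le 0 (- x) = cone_le x 0.
  by rewrite -(cone_sub_ge0 x) sub0r.
have := cone_le0_total x; case: (boolP (cone_le x 0)) => [h1|_].
  by case: (boolP (cone_le 0 x)) => // h2 _; rewrite (cone_le0_anti h2 h1) oppr0.
by rewrite orbF => ->.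
Qed.

Fact cone_ge0_norm x : cone_le 0 x -> cone_norm x = x.
Proof. by rewrite /cone_norm => ->. Qed.

HB.instance Definition _ := Num.IntegralDomain_isLeReal.Build cone_field
  cone_le0_add cone_le0_mul cone_le0_anti cone_sub_ge0 cone_le0_total
  cone_normN cone_ge0_norm (fun _ _ => erefl).

Lemma cone_ge0 (x : cone_field) : (0 <= x) <-> P (cone_val x).
Proof. by rewrite -[0 <= x]/(cone_le 0 x) cone_le0; split => /asboolP. Qed.

(** Weights are needed because nonnegative elements of [cone_field] are not yet known to be
    squares. *)
Definition weighted_sos (q : {poly cone_field}) :=
  exists2 s : seq (cone_field * {poly cone_field}), forall c, c \in s -> 0 <= c.1 &
    q = \sum_(c <- s) c.1 *: c.2 ^+ 2.

Lemma weighted_sosD p q : weighted_sos p -> weighted_sos q -> weighted_sos (p + q).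
Proof.
move=> [s s0 ->] [t t0 ->]; exists (s ++ t); last by rewrite big_cat.
by move=> c; rewrite mem_cat => /orP[/s0|/t0].
Qed.

Lemma weighted_sosM p q : weighted_sos p -> weighted_sos q -> weighted_sos (p * q).
Proof.
move=> [s s0 ->] [t t0 ->]; exists [seq (c.1 * d.1, c.2 * d.2) | c <- s, d <- t].
  by move=> _ /allpairsP[[c d] /= [/s0 c0 /t0 d0 ->]]; exact: mulr_ge0.
rewrite big_distrlr /= big_allpairs_dep; apply: eq_bigr => c _; apply: eq_bigr => d _ /=.
by rewrite exprMn -scalerAl -scalerAr scalerA.
Qed.

Lemma weighted_sosZ c q : 0 <= c -> weighted_sos (c *: q ^+ 2).
Proof.
move=> c0; exists [:: (c, q)]; last by rewrite big_seq1.
by move=> d; rewrite inE => /eqP->.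
Qed.

Lemma weighted_sos_sqr q : weighted_sos (q ^+ 2).
Proof. by rewrite -[_ ^+ 2]scale1r; exact: weighted_sosZ. Qed.

Local Notation cval := (map_poly (val : cone_field -> C)).

Hypothesis C_closed : forall p : {poly C}, size p != 1 -> exists x, root p x.

(** A root [z] in [C] is shown to lie in the subfield: the values at [z] of weighted sums of squares
    form a precone containing [P], so by maximality they are in [P]. *)
Lemma irreducible_sign_change (p : {poly cone_field}) a b :
  irreducible_poly p -> p.[a] * p.[b] < 0 -> exists x, root p x.
Proof.
move=> irr pab; have [z pz] : exists z, root (cval p) z.
  by apply: C_closed; rewrite size_map_poly neq_ltn irr orbT.
have bez h : (cval h).[z] != 0 -> exists v, (cval v).[z] * (cval h).[z] = 1.
  move=> hz; have : coprimep p h.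
    rewrite (irreducible_poly_coprime _ irr); apply: contra hz => /dvdpP[q ->].
    by rewrite rmorphM hornerM (rootP pz) mulr0.
  move=> /Bezout_eq1_coprimepP[[u v] /= e]; exists v.
  have := congr1 (fun h => (cval h).[z]) e.
  by rewrite rmorphD !rmorphM hornerD !hornerM (rootP pz) mulr0 add0r rmorph1 hornerC.
pose Q x := exists2 q, weighted_sos q & x = (cval q).[z].
have PQ x : P x -> Q x.
  move=> px; have xm : x \in cone_mem by apply/cone_memP; left.
  exists (ConeField xm *: 1 ^+ 2); last by rewrite expr1n map_polyZ rmorph1 hornerZ hornerC mulr1.
  by apply/weighted_sosZ/cone_ge0.
have Qsqr q : Q ((cval q).[z] ^+ 2).
  by exists (q ^+ 2); [exact: weighted_sos_sqr | rewrite rmorphXn horner_exp].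
have pQ : precone Q.
  split.
  - exact: PQ (precone1 pP).
  - move=> _ _ [p1 w1 ->] [p2 w2 ->]; exists (p1 + p2); first exact: weighted_sosD.
    by rewrite rmorphD hornerD.
  - move=> _ _ [p1 w1 ->] [p2 w2 ->]; exists (p1 * p2); first exact: weighted_sosM.
    by rewrite rmorphM hornerM.
  - move=> _ [q w ->]; have [->|nz] := eqVneq (cval q).[z] 0.
      by rewrite invr0; exact: PQ max_cone0.
    (* With [v] inverse to [q] at [z], the inverse of q(z) is v(z)^2 q(z). *)
    have [v e] := bez _ nz; exists (v ^+ 2 * q).
      by apply: weighted_sosM => //; exact: weighted_sos_sqr.
    rewrite rmorphM rmorphXn hornerM horner_exp expr2 -mulrA e mulr1.
    by rewrite -[LHS]mul1r -e mulfK.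
  - move=> _ _ [p1 w1 ->] [p2 w2 ->].
    have -> : (cval p1).[z] - (cval p2).[z] = (cval (p1 - p2)).[z].
      by rewrite rmorphB hornerD hornerN.
    exact: Qsqr.
  (* If q(z) = -1, then 1 + q shares the root [z] with the irreducible [p] and is divisible by it,
     against the sign change. *)
  - move=> [q [s s0 eq] e].
    have := sign_change_ndvdp pab s0; rewrite -eq => /negP; apply.
    apply: contrapT => /negP nd; move: nd.
    rewrite -(irreducible_poly_coprime _ irr) => /Bezout_eq1_coprimepP[[u v] /= e'].
    have := congr1 (fun h => (cval h).[z]) e'.
    rewrite rmorphD !rmorphM hornerD !hornerM (rootP pz) mulr0 add0r.
    rewrite rmorphD !rmorph1 hornerD !hornerC -e subrr mulr0 => /esym/eqP.
    by rewrite oner_eq0.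
have QP := max_cone_max pQ PQ.
have zm : z \in cone_mem.
  have sq (c : cone_field) : P ((z + val c) ^+ 2).
    apply: QP; have -> : z + val c = (cval ('X + c%:P)).[z].
      by rewrite map_polyXaddC hornerD hornerX hornerC.
    exact: Qsqr.
  (* The identity 4 z = (z + 1)^2 - (z - 1)^2 writes [z] through elements of [P]. *)
  have -> : z = ((z + val (1 : cone_field)) ^+ 2 - (z + val (-1 : cone_field)) ^+ 2) / (2 * 2).
    rewrite rmorphN rmorph1; field.
    have -> : (4 : C) = 2 * 2 by ring.
    exact: mulf_neq0 max_cone_two_neq0 max_cone_two_neq0.
  have [_ mB mD] := cone_mem_divring; apply: mD; last first.
    by apply/cone_memP; left; apply: (pM); apply: (pD); exact: (precone1 pP).
  by apply: mB; apply/cone_memP; left; exact: sq.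
exists (ConeField zm); apply/eqP; apply: val_inj.
by rewrite rmorph0 -horner_map; exact: rootP.
Qed.

(** In a proper factorization one factor changes sign. An irreducible polynomial that changes sign
    has a root, hence is linear, and then the root lies between [a] and [b]. *)
Lemma sign_change_root (p : {poly cone_field}) a b :
  a < b -> p.[a] * p.[b] < 0 -> exists2 x, a < x < b & root p x.
Proof.
move=> ab; elim: {p}(size p) {-2}p (leqnn (size p)) => [|n IHn] p sp pab.
  by move: sp pab; rewrite leqn0 size_poly_eq0 => /eqP->; rewrite !horner0 mulr0 ltxx.
have p0 : p != 0 by apply: contraTneq pab => ->; rewrite !horner0 mulr0 ltxx.
have sz1 : (1 < size p)%N.
  rewrite ltnNge; apply: contraTN pab => /size1_polyC ->.
  by rewrite !hornerC -leNgt -expr2 sqr_ge0.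
have [irr|nirr] := pselect (irreducible_poly p).
  have [x px] := irreducible_sign_change irr pab; exists x => //.
  have : ('X - x%:P) %= p.
    by apply: (apply_irredp irr); rewrite ?size_XsubC // dvdp_XsubCl.
  move=> /eqp_eq; rewrite lead_coefXsubC scale1r => e.
  move: pab; rewrite -e !hornerZ !hornerXsubC mulrACA.
  rewrite pmulr_rlt0; last by rewrite -expr2 exprn_even_gt0 //= lead_coef_eq0.
  move=> h; have [ax|xa] := ltP a x; last first.
    by move: h; rewrite ltNge mulr_ge0 ?subr_ge0 // (le_trans xa) // ltW.
  by move: h; rewrite nmulr_rlt0 ?subr_lt0 // subr_gt0 => ->.
have [q [q1 qp nqp]] : exists q : {poly cone_field}, [/\ size q != 1%N, q %| p & ~~ (q %= p)].
  apply: contrapT => h; apply: nirr; split=> // q q1 qp.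
  by apply: contrapT => /negP nqp; apply: h; exists q.
have /dvdpP[r er] := qp.
have q0 : q != 0 by apply: contraNneq p0 => q0; rewrite er q0 mulr0.
have r0 : r != 0 by apply: contraNneq p0 => r0; rewrite er r0 mul0r.
have sq : (size q < size p)%N.
  by rewrite ltn_neqAle dvdp_leq // andbT dvdp_size_eqp.
have sr : (size r < size p)%N.
  have : (1 < size q)%N by rewrite ltn_neqAle eq_sym q1 size_poly_gt0.
  rewrite er size_mul //; case: (size q) => [|[|k]] // _.
  by rewrite addnS /= addnS ltnS leq_addr.
have [qab|qab] := ltP (q.[a] * q.[b]) 0.
  have [|x xab qx] := IHn q _ qab; first by rewrite -ltnS (leq_trans sq).
  by exists x => //; rewrite er rootM qx orbT.
have rab : r.[a] * r.[b] < 0.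
  move: pab; rewrite er !hornerM mulrACA => h; rewrite ltNge; apply/negP => h'.
  by move: h; rewrite ltNge mulr_ge0.
have [|x xab rx] := IHn r _ rab; first by rewrite -ltnS (leq_trans sr).
by exists x => //; rewrite er rootM rx.
Qed.

Lemma cone_field_rcf : Num.real_closed_axiom cone_field.
Proof.
move=> p a b ab /andP[pa pb].
have [pa0|pa0] := eqVneq p.[a] 0; first by exists a; rewrite ?lexx //; exact/rootP.
have [pb0|pb0] := eqVneq p.[b] 0; first by exists b; rewrite ?lexx ?ab //; exact/rootP.
have pab : p.[a] * p.[b] < 0.
  by rewrite nmulr_rlt0 ?lt_neqAle ?pa0 // eq_sym pb0.
have [eab|nab] := eqVneq a b.
  by move: pab; rewrite eab -expr2 ltNge sqr_ge0.
have [|x /andP[ax xb] px] := sign_change_root _ pab; first by rewrite lt_neqAle nab.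
by exists x; rewrite ?ltW.
Qed.

End MaxConeTheory.

Lemma real_closure (C : fieldType) (P0 : C -> Prop) :
  (forall p : {poly C}, size p != 1 -> exists x, root p x) -> precone P0 ->
  exists (L : rcfType) (j : {rmorphism L -> C}),
    forall x, P0 x -> exists2 y, 0 <= y & j y = x.
Proof.
move=> C_closed pP0; have [P P0P] := max_cone_exists pP0.
pose M := Num.RealField_isClosed.Build (cone_field P) (cone_field_rcf C_closed).
pose L : rcfType := HB.pack (cone_field P) M.
exists L, (val : cone_field P -> C) => x /P0P px.
have xm : x \in cone_mem P by apply/cone_memP; left.
by exists (ConeField xm : L) => //; apply/cone_ge0.
Qed.

(** * An algebraically closed field containing the polynomials *)

Section Ultrapower.
Import classical_sets functions filter.
Local Open Scope classical_set_scope.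
Variables (X : pointedType) (F : closedFieldType) (U : set_system X).
Hypothesis U_ultra : UltraFilter U.

Definition null_pred : pred (X -> F) := fun g => `[< U [set x | g x = 0] >].

Lemma null_predP g : g \in null_pred <-> U [set x | g x = 0].
Proof. by split=> h; apply/asboolP. Qed.

Lemma null_pred_idealr : idealr_closed null_pred.
Proof.
split.
- by apply/null_predP; apply: filterE.
- apply/negP => /null_predP h; have [x /= /eqP] := filter_ex h.
  by rewrite oner_eq0.
- move=> a u v /null_predP hu /null_predP hv; apply/null_predP.
  by apply: filterS2 hu hv => x /= ux vx; rewrite -[LHS]/(a x * u x + v x) ux vx mulr0 addr0.
Qed.

HB.instance Definition _ := isIdealr.Build (X -> F) null_pred null_pred_idealr.

Definition null_ideal : idealr (X -> F) := null_pred.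
Definition ultrapower := {ideal_quot null_ideal}.

HB.instance Definition _ := GRing.ComNzRing.on ultrapower.

Definition to_ultrapower (g : X -> F) : ultrapower := \pi_(ultrapower)%qT g.

Lemma to_ultrapower_is_additive : additive to_ultrapower.
Proof. by move=> g h; rewrite /to_ultrapower !piE. Qed.

Lemma to_ultrapower_is_multiplicative : multiplicative to_ultrapower.
Proof. by split=> [g h|]; rewrite /to_ultrapower !piE. Qed.

HB.instance Definition _ :=
  GRing.isAdditive.Build (X -> F) ultrapower to_ultrapower to_ultrapower_is_additive.
HB.instance Definition _ :=
  GRing.isMultiplicative.Build (X -> F) ultrapower to_ultrapower
    to_ultrapower_is_multiplicative.

Lemma to_ultrapower_eq0 (g : X -> F) : to_ultrapower g = 0 <-> U [set x | g x = 0].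
Proof.
rewrite -null_predP; have := Quotient.equivE null_ideal g 0; rewrite subr0 => <-.
by rewrite /to_ultrapower; split=> [/eqP|h]; [|apply/eqP]; rewrite piE.
Qed.

(** Pointwise inversion is total because 0 is its own inverse; a representative of a nonzero class
    is nonzero on a set of the ultrafilter. *)
Definition ultrapower_inv (z : ultrapower) : ultrapower :=
  to_ultrapower (fun x => (repr z x)^-1).

Lemma ultrapower_mulVf z : z != 0 -> ultrapower_inv z * z = 1.
Proof.
move=> z0; rewrite -{2}[z]reprK -/(to_ultrapower (repr z)) -rmorphM.
apply/eqP; rewrite -subr_eq0 -(rmorph1 to_ultrapower) -rmorphB; apply/eqP.
apply/to_ultrapower_eq0.
have [h|h] := in_ultra_setVsetC [set x | repr z x = 0] U_ultra.
  by move/to_ultrapower_eq0: h; rewrite /to_ultrapower reprK => h; rewrite h eqxx in z0.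
by apply: filterS h => x /= /eqP zx; rewrite -[LHS]/((repr z x)^-1 * repr z x - 1) mulVf ?subrr.
Qed.

Lemma ultrapower_inv0 : ultrapower_inv 0 = 0.
Proof.
apply/to_ultrapower_eq0; have : to_ultrapower (repr (0 : ultrapower)) = 0.
  by rewrite /to_ultrapower reprK.
by move=> /to_ultrapower_eq0; apply: filterS => x /= ->; rewrite invr0.
Qed.

HB.instance Definition _ := GRing.ComNzRing_isField.Build ultrapower
  ultrapower_mulVf ultrapower_inv0.

(** Roots are chosen pointwise where the leading coefficient is nonzero, so that the degree does not
    drop; this happens on a set of the ultrafilter. *)
Lemma ultrapower_root (p : {poly ultrapower}) : size p != 1%N -> exists z, root p z.
Proof.
move=> sp; have [->|p0] := eqVneq p 0; first by exists 0; rewrite root0.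
pose P x : {poly F} := \poly_(i < size p) repr p`_i x.
have ex x : exists r, lead_coef p = 0 \/ repr (lead_coef p) x = 0 \/ root (P x) r.
  have [l0|l0] := eqVneq (repr (lead_coef p) x) 0; first by exists 0; right; left.
  have sP : size (P x) = size p by rewrite size_poly_eq.
  have /closed_rootP[r] : size (P x) != 1%N by rewrite sP.
  by exists r; right; right.
have [g gP] := choice ex; exists (to_ultrapower g).
have lU : U [set x | repr (lead_coef p) x <> 0].
  have [h|//] := in_ultra_setVsetC [set x | repr (lead_coef p) x = 0] U_ultra.
  move/to_ultrapower_eq0: h; rewrite /to_ultrapower reprK => /eqP.
  by rewrite lead_coef_eq0 (negbTE p0).
have -> : p = \sum_(i < size p) to_ultrapower (repr p`_i) *: 'X^i.
  rewrite -{1}[p]coefK poly_def; apply: eq_bigr => i _.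
  by rewrite /to_ultrapower reprK.
apply/rootP; rewrite horner_sum.
rewrite (eq_bigr (fun i : 'I_(size p) => to_ultrapower (repr p`_i * g ^+ i))); last first.
  by move=> i _; rewrite hornerZ hornerXn rmorphM rmorphXn.
rewrite -rmorph_sum; apply/to_ultrapower_eq0.
apply: filterS lU => x /= lx; have [/eqP|[//|/rootP]] := gP x.
  by rewrite lead_coef_eq0 (negbTE p0).
rewrite horner_poly => e; rewrite -[RHS]e fct_sumE; apply: eq_bigr => i _.
by rewrite mulrfctE /= exprfctE.
Qed.

End Ultrapower.

(** The leading coefficient in the last variable is nonzero at some [a]; the Cauchy bound of the
    specialized polynomial is then no root of it. *)
Lemma mpoly_neq0_point (R : rcfType) (n : nat) (f : {mpoly R[n]}) :
  f != 0 -> exists a : 'I_n -> R, f.@[a] != 0.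
Proof.
elim: n f => [|n IHn] f f0.
  exists (fun=> 0); rewrite [f]nvar0_mpolyC mevalC; apply: contra f0 => /eqP e.
  by rewrite [f]nvar0_mpolyC e mpolyC0.
have u0 : muni f != 0.
  (* Evaluation at the variables themselves recovers [f] from [muni f]. *)
  apply: contra f0 => /eqP e; have := mmap_muni (@mpolyC n.+1 R) (fun i => 'X_i) f.
  rewrite e rmorph0 horner0 /mmap => <-; apply/eqP; rewrite [LHS]mpolyE.
  by apply: eq_bigr => m _; rewrite mmap1_id mul_mpolyC.
have [a fa] : exists a, map_poly (mmap idfun a) (muni f) != 0.
  have lc0 : lead_coef (muni f) != 0 by rewrite lead_coef_eq0.
  have [a la] := IHn _ lc0; exists a; apply: contra la => /eqP e.
  by rewrite /meval lead_coefE -coef_map e coef0.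
set p := map_poly _ _ in fa; pose u := cauchy_bound p.
have pu : p.[u] != 0.
  by have := ge_cauchy_bound fa (x := u); rewrite in_itv /= lexx /root; apply.
pose b (i : 'I_n.+1) := oapp a u (unlift ord_max i).
exists b; rewrite /meval mmap_muni.
have -> : (fun i => b (widen_ord (leqnSn n) i)) = a.
  apply/funext => i; rewrite /b.
  have -> : widen_ord (leqnSn n) i = lift ord_max i.
    by apply: val_inj; rewrite /= /bump leqNgt ltn_ord.
  by rewrite liftK.
by rewrite /b unlift_none.
Qed.

Lemma mpoly_eq0P (R : rcfType) (n : nat) (f : {mpoly R[n]}) :
  (forall a : 'I_n -> R, f.@[a] = 0) -> f = 0.
Proof.
move=> h; apply/eqP; apply: contrapT => /negP /mpoly_neq0_point[a].
by rewrite h eqxx.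
Qed.

Section ClosedFieldEmbedding.
Import classical_sets functions filter.

Definition mpoly_point (R : rcfType) (n : nat) := 'I_n -> R.
HB.instance Definition _ R n := gen_eqMixin (mpoly_point R n).
HB.instance Definition _ R n := gen_choiceMixin (mpoly_point R n).
HB.instance Definition _ R n := isPointed.Build (mpoly_point R n) (fun=> 0).

(** The nonvanishing sets of two nonzero polynomials meet in that of their product, so these sets
    generate a proper filter. *)
Lemma mpoly_ultrafilter (R : rcfType) (n : nat) :
  exists U : set_system (mpoly_point R n), UltraFilter U /\
    forall f : {mpoly R[n]}, f != 0 -> U [set a : mpoly_point R n | f.@[a] != 0]%classic.
Proof.
pose G : set_system (mpoly_point R n) := fun A =>
  exists2 f : {mpoly R[n]}, f != 0 & forall a, f.@[a] != 0 -> A a.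
have PG : ProperFilter G.
  split.
    by move=> [f /mpoly_neq0_point[a fa] /(_ a fa)].
  split.
  - by exists 1 => //; exact: oner_neq0.
  - move=> A B [f f0 fA] [g g0 gB]; exists (f * g); first exact: mulf_neq0.
    by move=> a; rewrite mevalM mulf_eq0 negb_or => /andP[/fA ? /gB].
  - by move=> A B AB [f f0 fA]; exists f => // a /fA /AB.
have [U [UU GU]] := ultraFilterLemma PG; exists U; split=> // f f0.
by apply: GU; exists f.
Qed.

Lemma mpoly_closed_field (R : rcfType) (n : nat) :
  exists (C : fieldType) (iota : {rmorphism {mpoly R[n]} -> C}),
    injective iota /\ forall p : {poly C}, size p != 1 -> exists x, root p x.
Proof.
have [U [UU Upos]] := mpoly_ultrafilter R n.
pose ev (f : {mpoly R[n]}) : mpoly_point R n -> R[i]%C := fun a => (f.@[a])%:C%C.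
have evB : additive ev.
  by move=> f g; apply/funext => a; rewrite /ev mevalB rmorphB.
have evM : multiplicative ev.
  by split=> [f g|]; apply/funext => a; rewrite /ev ?mevalM ?rmorphM // meval1.
pose Ma := GRing.isAdditive.Build _ _ ev evB.
pose Mm := GRing.isMultiplicative.Build _ _ ev evM.
pose evm : {rmorphism {mpoly R[n]} -> (mpoly_point R n -> R[i]%C)} := HB.pack ev Ma Mm.
pose C : fieldType := ultrapower R[i]%C UU.
pose iota : {rmorphism {mpoly R[n]} -> C} := @to_ultrapower _ R[i]%C _ UU \o evm.
exists C, iota; split; last exact: ultrapower_root.
apply: raddf_inj => f /to_ultrapower_eq0 h; apply/eqP; apply: contrapT => /negP /Upos f0.
have [a /= [fa]] := filter_ex (filterI h f0).
by move: fa => /complexI ->; rewrite eqxx.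
Qed.
End ClosedFieldEmbedding.

(** * Hilbert's 17th problem *)

Section SumsOfSquares.
Variables (R : realType) (k : nat).
Implicit Types p q : {mpoly R[k]}.

Lemma is_sos_sqr p : is_sos (p ^+ 2).
Proof. by exists [:: p]; rewrite big_seq1. Qed.

Lemma is_sos0 : is_sos (0 : {mpoly R[k]}).
Proof. by exists [::]; rewrite big_nil. Qed.

Lemma is_sos1 : is_sos (1 : {mpoly R[k]}).
Proof. by rewrite -(expr1n _ 2); exact: is_sos_sqr. Qed.

Lemma is_sosD p q : is_sos p -> is_sos q -> is_sos (p + q).
Proof. by move=> [s ->] [t ->]; exists (s ++ t); rewrite big_cat. Qed.

Lemma is_sosM p q : is_sos p -> is_sos q -> is_sos (p * q).
Proof.
move=> [s ->] [t ->]; exists [seq a * b | a <- s, b <- t].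
rewrite big_distrlr /= big_allpairs_dep; apply: eq_bigr => a _; apply: eq_bigr => b _.
by rewrite exprMn.
Qed.

Lemma is_sos_ge0 p a : is_sos p -> 0 <= p.@[a].
Proof.
by move=> [s ->]; rewrite rmorph_sum sumr_ge0 // => q _; rewrite rmorphXn sqr_ge0.
Qed.

End SumsOfSquares.

Lemma rmorph_factor (A : comNzRingType) (L C : fieldType) (iota : {rmorphism A -> C})
    (j : {rmorphism L -> C}) :
  (forall a, exists y, j y = iota a) ->
  exists phi : {rmorphism A -> L}, forall a, j (phi a) = iota a.
Proof.
move=> /choice[f jf].
have fB : additive f by move=> a b; apply: (fmorph_inj j); rewrite rmorphB !jf rmorphB.
have fM : multiplicative f.
  split=> [a b|]; apply: (fmorph_inj j); first by rewrite rmorphM !jf rmorphM.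
  by rewrite jf !rmorph1.
pose Ma := GRing.isAdditive.Build _ _ f fB.
pose Mm := GRing.isMultiplicative.Build _ _ f fM.
by exists (HB.pack f Ma Mm : {rmorphism A -> L}).
Qed.

Section Hilbert17.
Variables (R : realType) (n : nat) (f : {mpoly R[n]}).
Hypothesis f_nsos : forall tau, is_sos tau -> tau != 0 -> ~ is_sos (tau * f).
Variables (C : fieldType) (iota : {rmorphism {mpoly R[n]} -> C}).
Hypothesis iota_inj : injective iota.

Definition neg_cone (x : C) := exists a b h : {mpoly R[n]},
  [/\ is_sos a, is_sos b, h != 0 & x * iota h ^+ 2 = iota (a - b * f)].

Let iota0 h : (iota h == 0) = (h == 0).
Proof. by apply/eqP/eqP => [|->]; rewrite ?rmorph0 // -{1}(rmorph0 iota) => /iota_inj. Qed.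

Lemma is_sos_addr_sqr_neq0 (a h : {mpoly R[n]}) : is_sos a -> h != 0 -> a + h ^+ 2 != 0.
Proof.
move=> sa /mpoly_neq0_point[v hv]; apply: contraNneq hv => e.
have : (a + h ^+ 2).@[v] = 0 by rewrite e meval0.
rewrite mevalD rmorphXn /= => /eqP; rewrite paddr_eq0 ?sqr_ge0 ?is_sos_ge0 //.
by rewrite sqrf_eq0 => /andP[].
Qed.

(** The case of -1 is where [f_nsos] enters: -1 = (a - b f) / h^2 means b f = a + h^2, a nonzero sum
    of squares, so [b] would be a multiplier for [f]. *)
Lemma neg_cone_precone : precone neg_cone.
Proof.
split.
- exists 1, 0, 1; split; [exact: is_sos1|exact: is_sos0|exact: oner_neq0|].
  by rewrite mul0r subr0 rmorph1 expr1n mul1r.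
- move=> x y [a [b [h [sa sb h0 ex]]]] [c [d [k [sc sd k0 ey]]]].
  exists (a * k ^+ 2 + c * h ^+ 2), (b * k ^+ 2 + d * h ^+ 2), (h * k).
  split; try by apply: is_sosD; apply: is_sosM => //; exact: is_sos_sqr.
    exact: mulf_neq0.
  have -> : a * k ^+ 2 + c * h ^+ 2 - (b * k ^+ 2 + d * h ^+ 2) * f =
     (a - b * f) * k ^+ 2 + (c - d * f) * h ^+ 2 by ring.
  rewrite rmorphD (rmorphM iota (a - b * f)) (rmorphM iota (c - d * f)) -ex -ey.
  by rewrite (rmorphM iota h k) !rmorphXn /=; ring.
- move=> x y [a [b [h [sa sb h0 ex]]]] [c [d [k [sc sd k0 ey]]]].
  exists (a * c + b * d * f ^+ 2), (a * d + b * c), (h * k).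
  split; [|by apply: is_sosD; exact: is_sosM|exact: mulf_neq0|].
    by apply: is_sosD; [exact: is_sosM|apply: is_sosM; [exact: is_sosM|exact: is_sos_sqr]].
  have -> : a * c + b * d * f ^+ 2 - (a * d + b * c) * f = (a - b * f) * (c - d * f) by ring.
  by rewrite (rmorphM iota (a - b * f)) -ex -ey (rmorphM iota h k); ring.
- move=> x [a [b [h [sa sb h0 ex]]]].
  have [->|x0] := eqVneq x 0.
    exists 0, 0, 1; split; [exact: is_sos0|exact: is_sos0|exact: oner_neq0|].
    by rewrite invr0 !mul0r subr0 rmorph0.
  (* The inverse of (a - b f) / h^2, expanded so that its denominator (a - b f)^2 is a square. *)
  exists (h ^+ 2 * a), (h ^+ 2 * b), (a - b * f).
  split; try by apply: is_sosM => //; exact: is_sos_sqr.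
    by rewrite -iota0 -ex mulf_neq0 // expf_neq0 // iota0.
  have -> : h ^+ 2 * a - h ^+ 2 * b * f = h ^+ 2 * (a - b * f) by ring.
  rewrite (rmorphM iota (h ^+ 2)) -ex rmorphXn /=; move: (iota h) => z.
  transitivity (x^-1 * x * (x * z ^+ 4)); first by ring.
  by rewrite mulVf //; ring.
- move=> x y [a [b [h [sa sb h0 ex]]]] [c [d [k [sc sd k0 ey]]]].
  exists (((a - b * f) * k ^+ 2 - (c - d * f) * h ^+ 2) ^+ 2), 0, ((h * k) ^+ 2).
  split; [exact: is_sos_sqr|exact: is_sos0|by rewrite expf_neq0 ?mulf_neq0|].
  rewrite mul0r subr0 [in RHS]rmorphXn /= rmorphB.
  rewrite (rmorphM iota (a - b * f)) (rmorphM iota (c - d * f)) -ex -ey.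
  by rewrite !rmorphXn /= (rmorphM iota h k); ring.
- move=> [a [b [h [sa sb h0]]]]; rewrite mulN1r -rmorphXn -rmorphN => /iota_inj e.
  have e' : b * f = a + h ^+ 2 by rewrite -[h ^+ 2]opprK e; ring.
  apply: (f_nsos sb); last by rewrite e'; apply: is_sosD => //; exact: is_sos_sqr.
  apply: contraTneq isT => b0; have := is_sos_addr_sqr_neq0 sa h0.
  by rewrite -e' b0 mul0r eqxx.
Qed.

End Hilbert17.

Theorem hilbert17 (R : realType) (n : nat) (f : {mpoly R[n]}) :
  (forall a : 'I_n -> R, 0 <= f.@[a]) ->
  exists tau, [/\ is_sos tau, tau != 0 & is_sos (tau * f)].
Proof.
move=> f_ge0; apply: contrapT => nex.
have f_nsos tau : is_sos tau -> tau != 0 -> ~ is_sos (tau * f).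
  by move=> s t0 st; apply: nex; exists tau.
have [C [iota [iota_inj C_closed]]] := mpoly_closed_field R n.
have pN := neg_cone_precone f_nsos iota_inj.
have [L [j jN]] := real_closure C_closed pN.
have NC a : is_sos a -> neg_cone f iota (iota a).
  move=> sa; exists a, 0, 1; split; [by []|exact: is_sos0|exact: oner_neq0|].
  by rewrite mul0r subr0 rmorph1 expr1n mulr1.
(* Every polynomial is a difference of squares, a = ((a + 1) / 2)^2 - ((a - 1) / 2)^2, and squares
   lie in the cone; so the image of R[x] lies in [L]. *)
have [|phi jphi] := @rmorph_factor _ _ _ iota j.
  move=> a; have [y _ ey] := jN _ (NC _ (is_sos_sqr ((a + 1) * (2^-1 : R)%:MP))).
  have [z _ ez] := jN _ (NC _ (is_sos_sqr ((a - 1) * (2^-1 : R)%:MP))).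
  exists (y - z); rewrite rmorphB ey ez -rmorphB; congr (iota _).
  have e2 : (2 : {mpoly R[n]}) * (2^-1)%:MP = 1.
    by rewrite -mpolyC_nat -mpolyCM divff ?mpolyC1 // pnatr_eq0.
  transitivity (a * (2 * (2^-1)%:MP) ^+ 2); first by ring.
  by rewrite e2 expr1n mulr1.
(* -f belongs to the cone; and [f] is not 0, since otherwise 1 would be a multiplier. *)
have phi_f : phi f < 0.
  rewrite lt_neqAle; apply/andP; split.
    apply/eqP => e; apply: (f_nsos 1); [exact: is_sos1|exact: oner_neq0|].
    have : iota f = iota 0 by rewrite -jphi e !rmorph0.
    by move=> /iota_inj ->; rewrite mulr0; exact: is_sos0.
  have [|y y0 ey] := jN (iota (- f)).
    exists 0, 1, 1; split; [exact: is_sos0|exact: is_sos1|exact: oner_neq0|].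
    by rewrite rmorph1 expr1n mulr1 mul1r sub0r.
  rewrite -oppr_ge0 -rmorphN; suff -> : phi (- f) = y by [].
  by apply: (fmorph_inj j); rewrite jphi ey.
pose phiC : {rmorphism R -> L} := phi \o (@mpolyC n R).
have [a aP] := mpoly_transfer phiC [:: f] (fun i => phi 'X_i).
have := aP f; rewrite inE eqxx => /(_ isT).
have -> : mmap phiC (fun i => phi 'X_i) f = phi f.
  rewrite [in RHS](mpolyE f) rmorph_sum; apply: eq_bigr => m _.
  rewrite -mul_mpolyC rmorphM; congr (_ * _).
  rewrite mpolyXE_id rmorph_prod; apply: eq_bigr => i _.
  by rewrite rmorphXn.
by rewrite (ltr0_sgz phi_f) => h; have := f_ge0 a; rewrite -sgz_ge0 h.
Qed.

Lemma is_cliqueP (T : finType) (e : rel T) (A : {set T}) :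
  reflect (forall u v, u \in A -> v \in A -> u != v -> e u v) (is_clique e A).
Proof.
apply: (iffP forall_inP) => h u.
  move=> v uA vA uv; have /forall_inP/(_ v vA)/implyP := h u uA; exact.
by move=> uA; apply/forall_inP => v vA; apply/implyP; exact: h.
Qed.

(** * Simplicial vertices of chordal graphs *)

Section Dirac.
Local Open Scope nat_scope.
Variables (T : finType) (e : rel T).
Hypotheses (e_sym : ssrbool.symmetric e) (e_irr : irreflexive e) (e_chordal : chordal e).

Definition simplicial (S : {set T}) (s : T) := is_clique e [set z in S | e s z].

Lemma path_shortcut (x : T) (p : seq T) (i k : nat) :
  path e x p -> uniq (x :: p) -> i < k < size p ->
  e (nth x (x :: p) i) (nth x p k) ->
  [/\ path e x (take i p ++ drop k p), uniq (x :: take i p ++ drop k p),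
      last x (take i p ++ drop k p) = last x p &
      size (take i p ++ drop k p) < size p].
Proof.
move=> pp up /andP[ik kp] eik.
have ip : i < size p by exact: ltn_trans ik kp.
have dk : drop k p = nth x p k :: drop k.+1 p by rewrite (drop_nth x kp).
have lasti : last x (take i p) = nth x (x :: p) i.
  rewrite (last_nth x) size_takel ?(ltnW ip) //.
  by case: i {ik eik} ip => //= i ip; rewrite nth_take.
have sub : subseq (take i p ++ drop k p) p.
  rewrite -{3}(cat_take_drop i p); apply: cat_subseq => //.
  by rewrite -(subnK (ltnW ik)) -drop_drop; exact: drop_subseq.
split.
- move: (pp); rewrite -{1}(cat_take_drop i p) cat_path => /andP[p1 _].
  rewrite cat_path p1 lasti dk /= eik /=.
  move: pp; rewrite -{1}(cat_take_drop k.+1 p) cat_path => /andP[_].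
  by rewrite (last_nth x) size_takel //= nth_take.
- apply: subseq_uniq up; rewrite /= eqxx; exact: sub.
- rewrite -{3}(cat_take_drop k p) !last_cat dk //.
- rewrite size_cat size_takel ?(ltnW ip) // size_drop.
  by rewrite addnBA ?(ltnW kp) // ltn_subLR ?ltn_add2r // (leq_trans (ltnW kp)) // leq_addl.
Qed.

(** In [x :: p] the vertex [nth x p k] has position [k.+1], so [i < k] singles out the
    nonconsecutive pairs. *)
Lemma shortest_path_chordless (x y : T) (K : {set T}) (p0 : seq T) :
  path e x p0 -> last x p0 = y -> (forall z, z \in p0 -> z != y -> z \in K) ->
  exists p, [/\ path e x p, uniq (x :: p), last x p = y,
    forall z, z \in p -> z != y -> z \in K &
    forall i k, i < k < size p -> ~~ e (nth x (x :: p) i) (nth x p k)].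
Proof.
move=> pp0 lp0 p0K.
pose good p := [/\ path e x p, uniq (x :: p), last x p = y &
  forall z, z \in p -> z != y -> z \in K].
have ex : exists k, `[< exists2 p, good p & size p = k >].
  case/shortenP: pp0 lp0 => p pp up sub lp; exists (size p); apply/asboolP.
  by exists p => //; split=> // z zp; apply: p0K; exact: sub.
case: (ex_minnP ex) => k /asboolP[p [pp up lp pK] sp] kmin.
exists p; split=> // i j ij; apply/negP => eij.
have [pp' up' lp' sp'] := path_shortcut pp up ij eij.
have := kmin (size (take i p ++ drop j p)); rewrite -sp leqNgt sp' => /(_ _)/negP.
apply=> //; apply/asboolP; eexists; last reflexivity; split=> //; first by rewrite lp'.
move=> z; rewrite mem_cat => zp; apply: pK.
by case/orP: zp => [/mem_take|/mem_drop].
Qed.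

Lemma next_head (x v : T) (s : seq T) : next (v :: x :: s) v = x.
Proof. by rewrite /= eqxx. Qed.

Lemma next_internal (v x : T) (p : seq T) i :
  uniq (v :: x :: p) -> i < size p ->
  next (v :: x :: p) (nth x (x :: p) i) = nth x p i.
Proof.
move=> up ip; rewrite next_nth.
have xs : nth x (x :: p) i \in v :: x :: p.
  by rewrite inE mem_nth ?orbT //= ltnW.
rewrite xs; have -> : index (nth x (x :: p) i) (v :: x :: p) = i.+1.
  rewrite -[nth x (x :: p) i]/(nth x (v :: x :: p) i.+1) index_uniq //=.
  by rewrite ltnS ltnS ltnW.
by rewrite /=; exact: set_nth_default.
Qed.

Lemma next_last (v x : T) (p : seq T) :
  uniq (v :: x :: p) -> next (v :: x :: p) (last x p) = v.
Proof.
move=> up; rewrite next_nth.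
have xs : last x p \in v :: x :: p by rewrite inE mem_last orbT.
rewrite xs; have -> : index (last x p) (v :: x :: p) = (size p).+1.
  have -> : last x p = nth x (v :: x :: p) (size p).+1 by rewrite (last_nth x).
  by rewrite index_uniq.
by rewrite nth_default.
Qed.

(* Together with v, a shortest path from x to y through K is a cycle without
   chord. *)
Lemma separator_adjacent (v x y : T) (K : {set T}) (p0 : seq T) :
  (forall z, z \in K -> ~~ e v z) -> v \notin K -> e v x -> e v y -> x != y ->
  path e x p0 -> last x p0 = y -> (forall z, z \in p0 -> z != y -> z \in K) ->
  e x y.
Proof.
move=> Kv vK vx vy xy pp0 lp0 p0K; apply: contraT => nexy.
have [p [pp up lp pK nochord]] := shortest_path_chordless pp0 lp0 p0K.
have vp : v \notin x :: p.
  rewrite inE negb_or; apply/andP; split.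
    by apply: contraTneq vx => ->; rewrite e_irr.
  apply/negP => vp; have := pK _ vp; case: eqVneq => [vy'|_ /(_ isT) vK'].
    by move: vy; rewrite vy' e_irr.
  by rewrite vK' in vK.
have us : uniq (v :: x :: p) by rewrite cons_uniq vp.
have sp : 1 < size p.
  case: (p) pp lp => [|a [|b q]] //=; first by move=> _ exy; rewrite exy eqxx in xy.
  by move=> /andP[exa _] ay; rewrite -ay exa in nexy.
have cs : ucycle e (v :: x :: p).
  rewrite /ucycle us andbT /= vx rcons_path pp lp /=.
  by rewrite e_sym vy.
have [|a [b [sa sb eab nba nab]]] := e_chordal (s := v :: x :: p) _ cs.
  by rewrite /= ltnS.
(* A chord at [v] would end in [K], where [v] has no neighbour, or at [x] or [y], which are next to
   [v] on the cycle; any other chord would be one of the shortest path. *)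
have main c d : c \in v :: x :: p -> d \in v :: x :: p -> e c d ->
    d != next (v :: x :: p) c -> c != next (v :: x :: p) d ->
    index c (v :: x :: p) < index d (v :: x :: p) -> False.
  move=> cs' ds ecd ndc ncd.
  have vd : c = v -> False.
    move=> cv; move: ds; rewrite inE => /orP[/eqP dv|].
      by move: ecd; rewrite cv dv e_irr.
    rewrite inE => /orP[/eqP dx|dp].
      by move: ndc; rewrite cv dx next_head eqxx.
    have := pK _ dp; case: eqVneq => [dy|_ /(_ isT) /Kv].
      by move: ncd; rewrite dy -lp next_last // cv eqxx.
    by rewrite -cv ecd.
  move: cs'; rewrite inE => /orP[/eqP/vd//|cp].
  move: ds; rewrite inE => /orP[/eqP dv|dp].
    by rewrite dv /= eqxx.
  have ic : index c (v :: x :: p) = (index c (x :: p)).+1.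
    by rewrite [LHS]/=; case: eqVneq => // cv; rewrite cv cp in vp.
  have id : index d (v :: x :: p) = (index d (x :: p)).+1.
    by rewrite [LHS]/=; case: eqVneq => // dv; rewrite dv dp in vp.
  rewrite ic id ltnS => lt.
  set i := index c _ in lt; set j := index d _ in lt.
  have jp : j < (size p).+1 by rewrite /j index_mem.
  have ip : i < size p by apply: leq_trans lt _.
  have ec : c = nth x (x :: p) i by rewrite nth_index.
  have ed : d = nth x (x :: p) j by rewrite nth_index.
  case: j jp lt ed => [//|j] jp lt ed.
  move: lt; rewrite ltnS leq_eqVlt => /orP[/eqP ij|ij].
    by move: ndc; rewrite ec next_internal // ed /= ij eqxx.
  have := nochord i j; rewrite ij => /(_ jp) /negP; apply.
  by move: ecd; rewrite {1}ec {1}ed.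
have [lt|lt|eq] := ltngtP (index a (v :: x :: p)) (index b (v :: x :: p)).
- by case: (main a b).
- by case: (main b a) => //; rewrite e_sym.
- have ab : a = b by rewrite -(nth_index v sa) eq nth_index.
  by move: eab; rewrite ab e_irr.
Qed.

(* K is a component of the non-neighbours of v and X its neighbourhood; X is a
   clique of neighbours of v, so a simplicial vertex of K :|: X lying in K is
   simplicial in S. *)
Lemma simplicial_nonadjacent (S : {set T}) (v w : T) :
  v \in S -> w \in S -> w != v -> ~~ e v w ->
  exists s, [/\ s \in S, s != v, ~~ e v s & simplicial S s].
Proof.
elim: {S}#|S| {-2}S (leqnn #|S|) v w => [|n IHn] S sS v w vS wS wv nvw.
  by move: sS vS; rewrite leqn0 cards_eq0 => /eqP ->; rewrite inE.
pose D := [set z in S | (z != v) && ~~ e v z].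
pose eD := [rel a b | [&& e a b, a \in D & b \in D]].
have eDsym : connect_sym eD.
  by apply: sym_connect_sym => a b /=; rewrite e_sym; congr (_ && _); rewrite andbC.
have wD : w \in D by rewrite inE wS wv nvw.
pose K := [set z | connect eD w z].
have KD z : z \in K -> z \in D.
  rewrite inE => /connectP[p pp ->]; elim: p (w) wD pp => //= a p IHp b bD.
  by move=> /andP[/and3P[_ _ aD]]; exact: IHp.
pose X := [set z in S | e v z && [exists k in K, e k z]].
pose G := K :|: X.
have Kv z : z \in K -> ~~ e v z by move=> /KD; rewrite inE => /and3P[].
have KS z : z \in K -> z \in S by move=> /KD; rewrite inE => /andP[].
have nvK z : z \in K -> z != v by move=> /KD; rewrite inE => /and3P[].
have vK : v \notin K by apply/negP => /nvK; rewrite eqxx.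
have XS z : z \in X -> [/\ z \in S, e v z & exists2 k, k \in K & e k z].
  by rewrite inE => /and3P[zS vz /exists_inP[k kK kz]]; split=> //; exists k.
have Xclique x y : x \in X -> y \in X -> x != y -> e x y.
  move=> /XS[xS vx [k kK kx]] /XS[yS vy [l lK ly]] xy.
  have : connect eD k l.
    by move: kK lK; rewrite !inE eDsym => wk wl; apply: connect_trans wk wl.
  move=> /connectP[p pp el].
  apply: (@separator_adjacent v x y K (k :: rcons p y)) => //=.
  - rewrite e_sym kx rcons_path -el ly andbT /=.
    by apply: sub_path pp => a b /= /andP[].
  - by rewrite last_rcons.
  - move=> z; rewrite inE mem_rcons inE => zp zy.
    have zkp : z \in k :: p.
      by move: zp; rewrite (negbTE zy) inE.
    rewrite inE; apply: connect_trans (path_connect pp zkp).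
    by move: kK; rewrite inE.
have nbrG s z : s \in K -> z \in S -> e s z -> z \in G.
  move=> sK zS sz; rewrite in_setU; case: (boolP (e v z)) => vz.
    by apply/orP; right; rewrite inE zS vz; apply/exists_inP; exists s.
  have zv : z != v by apply: contraNneq (Kv _ sK) => <-; rewrite e_sym.
  apply/orP; left; rewrite inE; move: (sK); rewrite inE => ws.
  by apply: connect_trans ws (connect1 _); rewrite /= sz KD // inE zS zv vz.
have lift s : s \in K -> simplicial G s ->
    exists s, [/\ s \in S, s != v, ~~ e v s & simplicial S s].
  move=> sK /is_cliqueP sG; exists s; split; [exact: KS|exact: nvK|exact: Kv|].
  apply/is_cliqueP => a b; rewrite !inE => /andP[aS sa] /andP[bS sb].
  by apply: sG; rewrite inE ?sa ?sb andbT; apply: (nbrG s).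
have GS : G \subset S.
  by apply/subsetP => z; rewrite in_setU => /orP[/KS//|/XS[]].
have sG : #|G| <= n.
  rewrite -ltnS (leq_trans _ sS) // proper_card //; apply/properP; split=> //.
  exists v => //; rewrite in_setU (negbTE vK) /=; apply/negP => /XS[_].
  by rewrite e_irr.
(* Induction from a [t] in [X] with a non-neighbour in [G]: the vertex found is not adjacent to [t],
   so it is outside the clique [X] and hence in [K]. *)
have [/existsP[t /existsP[u /and4P[tX uG ut ntu]]]|nX] :=
    boolP [exists t, exists u, [&& t \in X, u \in G, u != t & ~~ e t u]].
  have [|s [sG' st nts ss]] := IHn G sG t u _ uG ut ntu; first by rewrite in_setU tX orbT.
  apply: (lift s) => //; move: sG'; rewrite in_setU => /orP[//|sX].
  by move: nts; rewrite Xclique // eq_sym.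
have Xu t u : t \in X -> u \in G -> u != t -> e t u.
  move=> tX uG ut; apply: contraT => ntu; case/negP: nX.
  by apply/existsP; exists t; apply/existsP; exists u; rewrite tX uG ut ntu.
(* Now [X] is joined to all of [G], so a vertex not adjacent to some [k] in [K] must lie in [K] as
   well. *)
have [/existsP[k /existsP[u /and4P[kK uG uk nku]]]|nK] :=
    boolP [exists k, exists u, [&& k \in K, u \in G, u != k & ~~ e k u]].
  have kG : k \in G by rewrite in_setU kK.
  have [s [sG' sk nks ss]] := IHn G sG k u kG uG uk nku.
  apply: (lift s) => //; move: sG'; rewrite in_setU => /orP[//|sX].
  by move: nks; rewrite e_sym (Xu s k) // eq_sym.
(* In the remaining case [G] is a clique and [w] itself is simplicial in it. *)
apply: (lift w); first by rewrite inE connect0.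
apply/is_cliqueP => a b /setIdP[aG _] /setIdP[bG _] ab.
move: (aG); rewrite in_setU => /orP[aK|aX]; last by apply: Xu; rewrite // eq_sym.
apply: contraT => nab; case/negP: nK.
by apply/existsP; exists a; apply/existsP; exists b; rewrite aK bG eq_sym ab nab.
Qed.

Lemma simplicial_exists (S : {set T}) : S != set0 ->
  exists2 s, s \in S & simplicial S s.
Proof.
move=> /set0Pn[x xS].
have [/existsP[v /existsP[w /and4P[vS wS wv nvw]]]|nS] :=
    boolP [exists v, exists w, [&& v \in S, w \in S, w != v & ~~ e v w]].
  by have [s [sS _ _ ss]] := simplicial_nonadjacent vS wS wv nvw; exists s.
exists x => //; apply/is_cliqueP => a b; rewrite !inE => /andP[aS _] /andP[bS _] ab.
apply: contraT => nab; case/negP: nS.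
by apply/existsP; exists a; apply/existsP; exists b; rewrite aS bS eq_sym ab nab.
Qed.

End Dirac.

(** * Eliminating the variables y *)

Section Support.
Variables (R : idomainType) (k : nat).
Implicit Types (Q : 'X_{1..k} -> Prop) (p q : {mpoly R[k]}).

Definition supp_in Q p := forall mu, mu \in msupp p -> Q mu.

Lemma supp_in0 Q : supp_in Q 0.
Proof. by move=> mu; rewrite msupp0. Qed.

Lemma supp_inD Q p q : supp_in Q p -> supp_in Q q -> supp_in Q (p + q).
Proof.
by move=> hp hq mu /msuppD_le; rewrite mem_cat => /orP[/hp|/hq].
Qed.

Lemma supp_inN Q p : supp_in Q p -> supp_in Q (- p).
Proof. by move=> hp mu; rewrite (perm_mem (msuppN p)); exact: hp. Qed.

Lemma supp_in_sum Q (I : Type) (r : seq I) (P : pred I) (F : I -> {mpoly R[k]}) :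
  (forall i, P i -> supp_in Q (F i)) -> supp_in Q (\sum_(i <- r | P i) F i).
Proof. by move=> h; apply: big_ind; [exact: supp_in0|exact: supp_inD|]. Qed.

Lemma supp_inM Q1 Q2 Q p q : (forall mu nu, Q1 mu -> Q2 nu -> Q (mu + nu)%MM) ->
  supp_in Q1 p -> supp_in Q2 q -> supp_in Q (p * q).
Proof.
move=> h hp hq mu /msuppM_le /allpairsP[[a b] /= [/hp ha /hq hb ->]].
exact: h.
Qed.

Lemma supp_inX Q mu : Q mu -> supp_in Q ('X_[mu] : {mpoly R[k]}).
Proof. by move=> h nu; rewrite msuppX inE => /eqP->. Qed.

Lemma supp_inZ Q c p : supp_in Q p -> supp_in Q (c *: p).
Proof. by move=> hp mu /msuppZ_le; exact: hp. Qed.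

Lemma sub_supp_in Q1 Q2 p : (forall mu, Q1 mu -> Q2 mu) -> supp_in Q1 p -> supp_in Q2 p.
Proof. by move=> h hp mu /hp /h. Qed.

Lemma meval_eq_supp p (v w : 'I_k -> R) :
  supp_in (fun mu => forall i, mu i != 0%N -> v i = w i) p -> p.@[v] = p.@[w].
Proof.
move=> h; rewrite !mevalE; apply: eq_big_seq => mu /h hmu; congr (_ * _).
apply: eq_bigr => i _; have [->|/hmu ->//] := eqVneq (mu i) 0%N.
by rewrite !expr0.
Qed.

End Support.

Section Rename.
Variables (R : idomainType) (a b : nat) (g : 'I_a -> 'I_b).
Hypothesis g_inj : injective g.

Definition rename (s : {mpoly R[a]}) : {mpoly R[b]} := s \mPo [tuple 'X_(g i) | i < a].

Definition pull_mnm (mu : 'X_{1..b}) : 'X_{1..a} := [multinom mu (g i) | i < a].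

(** The condition on the support of [s] is what later bounds its degree in y. *)
Lemma rename_surj (u : {mpoly R[b]}) :
  supp_in (fun mu => forall j, mu j != 0%N -> exists i, g i = j) u ->
  exists2 s, rename s = u &
    supp_in (fun nu => exists2 mu, mu \in msupp u & nu = pull_mnm mu) s.
Proof.
move=> hu; exists (\sum_(mu <- msupp u) u@_mu *: 'X_[pull_mnm mu]).
  rewrite /rename [in RHS](mpolyE u) linear_sum /=; apply: eq_big_seq => mu /hu hmu.
  rewrite comp_mpolyZ comp_mpolyX [in RHS]mpolyXE_id; congr (_ *: _).
  rewrite (bigID (mem (codom g))) /= [X in _ = _ * X]big1 ?mulr1; last first.
    move=> j nj; have [->|/hmu[i ij]] := eqVneq (mu j) 0%N; first by rewrite expr0.
    by case/negP: nj; rewrite -ij codom_f.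
  rewrite (eq_bigl (mem [set g i | i in setT])); last first.
    move=> j; apply/codomP/imsetP => [[i ->]|[i _ ->]]; first by exists i; rewrite ?inE.
    by exists i.
  rewrite big_imset /=; last by move=> i j _ _; exact: g_inj.
  by apply: eq_big => [i|i _]; rewrite ?inE // tnth_mktuple mnmE.
rewrite big_seq; apply: supp_in_sum => mu hmu; apply: supp_inZ; apply: supp_inX.
by exists mu.
Qed.

Lemma meval_rename (s : {mpoly R[a]}) (w : 'I_b -> R) :
  (rename s).@[w] = s.@[fun i => w (g i)].
Proof.
rewrite /rename comp_mpoly_meval; apply: meval_eq => i.
by rewrite tnth_mktuple mevalXU.
Qed.

Lemma supp_in_rename (s : {mpoly R[a]}) :
  supp_in (fun mu => forall j, mu j != 0%N -> exists i, g i = j) (rename s).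
Proof.
rewrite /rename (mpolyE s) linear_sum /=; apply: supp_in_sum => mu _.
rewrite comp_mpolyZ comp_mpolyX; apply: supp_inZ.
apply: (big_ind (supp_in _)) => [|p q hp hq|i _].
- rewrite -mpolyC1 -[1%:MP]/(1 : {mpoly R[b]}) => nu; rewrite msupp1 inE => /eqP-> j.
  by rewrite mnm0E eqxx.
- apply: supp_inM hp hq => m1 m2 h1 h2 j; rewrite mnmDE addn_eq0 negb_and.
  by case/orP => [/h1|/h2].
- rewrite tnth_mktuple mpolyXn; apply: supp_inX => j.
  rewrite mulmnE mnm1E; case: (eqVneq (g i) j) => [<- _|_]; first by exists i.
  by rewrite mul0n eqxx.
Qed.

End Rename.

Section YDegree.
Variables (n m : nat).
Implicit Types (mu nu : 'X_{1..n + m}) (S A : {set 'I_m}).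

Definition ysupp S mu := forall j : 'I_m, mu (rshift n j) != 0%N -> j \in S.

Definition ylin A mu := (ydeg mu <= 1)%N /\ ysupp A mu.

Lemma ydegD mu nu : ydeg (mu + nu)%MM = (ydeg mu + ydeg nu)%N.
Proof. by rewrite /ydeg -big_split; apply: eq_bigr => j _; rewrite mnmDE. Qed.

Lemma ydegX mu k : ydeg (mu *+ k)%MM = (ydeg mu * k)%N.
Proof. by rewrite /ydeg big_distrl; apply: eq_bigr => j _; rewrite mulmnE. Qed.

Lemma ydegU (v : 'I_m) : ydeg U_(rshift n v)%MM = 1%N.
Proof.
rewrite /ydeg (bigD1 v) //= mnm1E eqxx big1 // => j jv.
by rewrite mnm1E (inj_eq (@rshift_inj n m)) eq_sym (negbTE jv).
Qed.

Lemma leq_ydeg mu j : (mu (rshift n j) <= ydeg mu)%N.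
Proof. by rewrite /ydeg (bigD1 j) //= leq_addr. Qed.

Lemma ydeg_eq0 mu : ydeg mu = 0%N -> forall j, mu (rshift n j) = 0%N.
Proof. by move=> h j; apply/eqP; rewrite -leqn0 -h leq_ydeg. Qed.

Lemma ysuppD S mu nu : ysupp S mu -> ysupp S nu -> ysupp S (mu + nu)%MM.
Proof.
move=> h1 h2 j; rewrite mnmDE addn_eq0 negb_and.
by case/orP => [/h1|/h2].
Qed.

Lemma ysupp_ydeg0 S mu : ydeg mu = 0%N -> ysupp S mu.
Proof. by move=> h j; rewrite (ydeg_eq0 h). Qed.

Variable e : rel 'I_m.

(** The invariant of the elimination: [e] remains the graph of the original polynomial, and only the
    set [S] of remaining variables shrinks. *)
Definition yquad S mu := [/\ (ydeg mu <= 2)%N, ysupp S mu &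
  forall i j, i != j -> mu (rshift n i) != 0%N -> mu (rshift n j) != 0%N -> e i j].

Variable R : realType.

(** Monomials are sorted by their exponent of y_v. If it is 1, at most one other y-variable occurs,
    and it is a neighbour of [v]; if it is 2, none occurs. *)
Lemma ydecomposition (S : {set 'I_m}) (v : 'I_m) (q : {mpoly R[n + m]}) :
  supp_in (yquad S) q -> exists a b c : {mpoly R[n + m]},
    [/\ q = a * 'X_(rshift n v) ^+ 2 + b * 'X_(rshift n v) + c,
        supp_in (fun mu => ydeg mu = 0%N) a,
        supp_in (ylin [set j in S :\ v | e v j]) b &
        supp_in (yquad (S :\ v)) c].
Proof.
set w := rshift n v; move=> hq; rewrite [q]mpolyE big_seq.
pose D (q : {mpoly R[n + m]}) := exists a b c : {mpoly R[n + m]},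
    [/\ q = a * 'X_w ^+ 2 + b * 'X_w + c,
        supp_in (fun mu => ydeg mu = 0%N) a,
        supp_in (ylin [set j in S :\ v | e v j]) b &
        supp_in (yquad (S :\ v)) c].
apply: (big_ind D) => [|p1 p2 [a [b [c [-> ha hb hc]]]] [a' [b' [c' [-> ha' hb' hc']]]]|mu mq].
- by exists 0, 0, 0; split; try exact: supp_in0; rewrite !mul0r !addr0.
- exists (a + a'), (b + b'), (c + c'); split; try exact: supp_inD; ring.
have [d2 sS pat] := hq mu mq; set k := q@_mu; pose nu := (mu - U_(w) *+ mu w)%MM.
have emu : mu = (nu + U_(w) *+ mu w)%MM.
  apply/mnmP => i; rewrite mnmDE mnmBE mulmnE mnm1E.
  by case: eqVneq => [->|_]; rewrite ?mul1n ?mul0n ?subnn ?add0n ?subn0 ?addn0.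
have dmu : ydeg mu = (ydeg nu + mu w)%N by rewrite {1}emu ydegD ydegX ydegU mul1n.
have eX : 'X_[mu] = 'X_[nu] * 'X_w ^+ mu w :> {mpoly R[n + m]}.
  by rewrite {1}emu mpolyXD mpolyXn.
have nuv : nu w = 0%N by rewrite mnmBE mulmnE mnm1E eqxx mul1n subnn.
have nui j : nu (rshift n j) != 0%N -> j != v /\ mu (rshift n j) != 0%N.
  move=> nj; have jv : j != v by apply: contraNneq nj => ->; rewrite -/w nuv.
  by split=> //; rewrite emu mnmDE addn_eq0 negb_and nj.
have muw : (mu w <= 2)%N by apply: leq_trans (leq_ydeg _ _) d2.
have snu : ysupp (S :\ v) nu.
  by move=> j /nui[jv /sS jS]; rewrite in_setD1 jv.
case E : (mu w) muw => [|[|[|//]]] _.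
- exists 0, 0, (k *: 'X_[mu]); split; try exact: supp_in0; first by ring.
  apply: supp_inZ; apply: supp_inX; split=> //.
  by rewrite emu E mulm0n addm0.
- exists 0, (k *: 'X_[nu]), 0; split; try exact: supp_in0.
    by rewrite eX E expr1 -scalerAl; ring.
  apply: supp_inZ; apply: supp_inX; split.
    by move: d2; rewrite dmu E addn1 ltnS.
  move=> j nj; rewrite inE snu //=; have [jv mj] := nui j nj.
  by apply: pat => //; [rewrite eq_sym | rewrite -/w E].
- exists (k *: 'X_[nu]), 0, 0; split; try exact: supp_in0.
    by rewrite eX E -scalerAl; ring.
  apply: supp_inZ; apply: supp_inX.
  by apply/eqP; move: d2; rewrite dmu E -{2}[2%N]add0n leq_add2r leqn0.
Qed.

End YDegree.

Lemma quadratic_ge0 (R : realFieldType) (a b c : R) :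
  (forall t, 0 <= a * t ^+ 2 + b * t + c) -> 0 <= a /\ 0 <= 4 * a * c - b ^+ 2.
Proof.
move=> h; have c0 : 0 <= c by have := h 0; rewrite expr0n /= !mulr0 !add0r.
have [a0|a0|a0] := ltgtP a 0.
(* For this [t] >= 1 one has a t = a - K, whence a t^2 + b t + c <= t (a - K + |b| + c) = t a <
   0. *)
- pose K := `|b| + c; pose t := 1 - K / a.
  have K0 : 0 <= K by rewrite addr_ge0.
  have t1 : 1 <= t by rewrite lerDl oppr_ge0 mulr_ge0_le0 // invr_le0 ltW.
  have at' : a * t = a - K by rewrite /t mulrBr mulr1 mulrCA divff ?mulr1 // lt_eqF.
  have bt : b * t <= `|b| * t by rewrite ler_wpM2r ?ler_norm // (le_trans ler01).
  have ct : c <= c * t by rewrite ler_peMr.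
  have ta : t * a < 0 by rewrite nmulr_llt0 // (lt_le_trans ltr01).
  have := h t; rewrite expr2 mulrA at' => h'.
  have : 0 <= t * a.
    apply: le_trans h' _; rewrite mulrBl (mulrC a) -addrA -addrA gerDl.
    by rewrite /K mulrDl; lra.
  by rewrite leNgt ta.
- split=> //.
  have := h (- b / (2 * a)).
  have -> : a * (- b / (2 * a)) ^+ 2 + b * (- b / (2 * a)) + c = (4 * a * c - b ^+ 2) / (4 * a).
    by field; rewrite gt_eqF.
  by rewrite pmulr_lge0 // invr_gt0 mulr_gt0.
- split=> //; rewrite a0 mulr0 mul0r sub0r oppr_ge0; suff -> : b = 0 by rewrite expr0n.
  apply/eqP; apply: contraT => b0; have := h (- (c + 1) / b).
  by rewrite a0 mul0r add0r mulrC divfK // addrC opprD addrA subrr sub0r ler0N1.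
Qed.

Lemma split_lshift (m n : nat) (i : 'I_m) : split (lshift n i) = inl i.
Proof. exact: (unsplitK (inl i)). Qed.

Lemma split_rshift (m n : nat) (i : 'I_n) : split (rshift m i) = inr i.
Proof. exact: (unsplitK (inr i)). Qed.

Section LiftX.
Variables (R : realType) (n m : nat).
Implicit Types (s : {mpoly R[n]}) (q : {mpoly R[n + m]}).

Lemma lift_xE s : lift_x m s = rename (lshift m) s.
Proof. by []. Qed.

Lemma lift_xM s t : lift_x m (s * t) = lift_x m s * lift_x m t.
Proof. exact: rmorphM. Qed.

Lemma lift_x_sum (I : Type) (r : seq I) (F : I -> {mpoly R[n]}) :
  lift_x m (\sum_(i <- r) F i) = \sum_(i <- r) lift_x m (F i).
Proof. exact: raddf_sum. Qed.

Lemma lift_x_sqr s : lift_x m (s ^+ 2) = lift_x m s ^+ 2.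
Proof. exact: rmorphXn. Qed.

Lemma lift_x_supp s : supp_in (fun mu : 'X_{1..n + m} => ydeg mu = 0%N) (lift_x m s).
Proof.
apply: (sub_supp_in _ (@supp_in_rename _ _ _ (lshift m) s)) => mu h.
rewrite /ydeg big1 // => j _; apply: contraTeq isT => /h; case=> i.
by move=> /eqP; rewrite eq_lrshift.
Qed.

Lemma lift_x_surj q : supp_in (fun mu : 'X_{1..n + m} => ydeg mu = 0%N) q ->
  exists s, lift_x m s = q.
Proof.
move=> hq; have [|s es _] := rename_surj (@lshift_inj n m) (u := q); last by exists s.
move=> mu /hq h j; case: (split_ordP j) => i ->; first by exists i.
by rewrite (ydeg_eq0 h).
Qed.

Lemma meval_lift_x s (w : 'I_(n + m) -> R) :
  (lift_x m s).@[w] = s.@[fun i => w (lshift m i)].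
Proof. by rewrite lift_xE meval_rename. Qed.

Lemma nonneg_xyP q : nonneg_xy q <-> forall w : 'I_(n + m) -> R, 0 <= q.@[w].
Proof.
split=> [h w|h x y]; last exact: h.
suff -> : q.@[w] = q.@[joint (fun i => w (lshift m i)) (fun j => w (rshift n j))] by [].
apply: meval_eq => i; rewrite /joint.
by case: (split_ordP i) => j ->; rewrite ?split_lshift ?split_rshift.
Qed.

End LiftX.

(** * Certificates supported on cliques *)

Section CliqueSums.
Variables (R : realType) (n m : nat) (e : rel 'I_m).
Implicit Types (q z : {mpoly R[n + m]}).

(** The cliques may be small and may repeat; they are assigned to maximal cliques only at the end,
    which keeps the induction free of maximality. *)
Definition clique_sum z := exists2 s : seq ({set 'I_m} * {mpoly R[n + m]}),
  (forall Au, Au \in s -> is_clique e Au.1 /\ supp_in (ylin Au.1) Au.2) &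
  z = \sum_(Au <- s) Au.2 ^+ 2.

Lemma clique_sumD z1 z2 : clique_sum z1 -> clique_sum z2 -> clique_sum (z1 + z2).
Proof.
move=> [s hs ->] [t ht ->]; exists (s ++ t); last by rewrite big_cat.
by move=> Au; rewrite mem_cat => /orP[/hs|/ht].
Qed.

Lemma clique_sum_sqr A u : is_clique e A -> supp_in (ylin A) u -> clique_sum (u ^+ 2).
Proof.
by move=> cA hu; exists [:: (A, u)]; [move=> Bv; rewrite inE => /eqP->|rewrite big_seq1].
Qed.

Lemma clique_sumZ s z : is_sos s -> clique_sum z -> clique_sum (lift_x m s * z).
Proof.
move=> [r ->] [t ht ->].
exists [seq (Au.1, lift_x m a * Au.2) | a <- r, Au <- t].
  move=> _ /allpairsP[[a Au] /= [_ /ht[cA hu] ->]] /=; split=> //.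
  apply: (supp_inM _ (@lift_x_supp _ _ _ _) hu) => mu nu mu0 [nu1 nuA]; split.
    by rewrite ydegD mu0.
  exact: (ysuppD (ysupp_ydeg0 _ mu0) nuA).
rewrite lift_x_sum big_distrlr /= big_allpairs_dep; apply: eq_bigr => a _.
by apply: eq_bigr => Au _; rewrite /= lift_x_sqr exprMn.
Qed.

Hypotheses (e_sym : ssrbool.symmetric e) (e_irr : irreflexive e) (e_chordal : chordal e).

Lemma is_clique_set0 : is_clique e set0.
Proof. by apply/is_cliqueP => u v; rewrite inE. Qed.

Lemma clique_certificate (S : {set 'I_m}) q :
  (forall w : 'I_(n + m) -> R, 0 <= q.@[w]) -> supp_in (yquad e S) q ->
  exists tau, [/\ is_sos tau, tau != 0 & clique_sum (lift_x m tau * q)].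
Proof.
elim: {S}#|S| {-2}S (erefl #|S|) q => [|d IHd] S cS q q_ge0 hq.
  have [|s es] := lift_x_surj (q := q).
    move=> mu /hq[_ h _]; move/eqP: cS; rewrite cards_eq0 => /eqP S0.
    by rewrite /ydeg big1 // => j _; apply: contraTeq isT => /h; rewrite S0 inE.
  have [|tau [stau tau0 st]] := hilbert17 (f := s).
    move=> a; pose w (i : 'I_(n + m)) := match split i with inl j => a j | inr _ => 0 end.
    have -> : s.@[a] = q.@[w].
      rewrite -es meval_lift_x; apply: meval_eq => i.
      by rewrite /w split_lshift.
    exact: q_ge0.
  exists tau; split=> //; rewrite -es -lift_xM -[lift_x _ _]mulr1.
  apply: clique_sumZ => //; rewrite -(expr1n _ 2).
  (* The remaining factor 1 is a square supported on the empty clique. *)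
  apply: (clique_sum_sqr is_clique_set0) => mu; rewrite msupp1 inE => /eqP->.
  have d0 : ydeg (0%MM : 'X_{1..n + m}) = 0%N by rewrite /ydeg big1 // => j _; rewrite mnm0E.
  by split; [rewrite d0 | exact: ysupp_ydeg0].
have [|v vS simp] := simplicial_exists e_sym e_irr e_chordal (S := S).
  by rewrite -cards_eq0 cS.
have [a [b [c [eq ha hb hc]]]] := ydecomposition v hq.
have [A eA] := lift_x_surj ha.
set N := [set j in S :\ v | e v j] in hb.
have cN : is_clique e (v |: N).
  move/is_cliqueP: simp => simp; apply/is_cliqueP => i j.
  rewrite !in_setU1 ![_ \in N]inE ![_ \in S :\ v]inE.
  move=> /orP[/eqP->|/andP[/andP[iv iS] vi]] /orP[/eqP->|/andP[/andP[jv jS] vj]] ij.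
  - by rewrite eqxx in ij.
  - exact: vj.
  - by rewrite e_sym.
  - by apply: simp => //; rewrite inE ?iS ?jS.
(* Replaces the coordinate y_v of [w] by [t]. The values of [a], [b], [c] do not change, so [q]
   becomes a quadratic in [t]. *)
pose w_ (w : 'I_(n + m) -> R) t i := if i == rshift n v then t else w i.
have indep q' w t : supp_in (fun mu => mu (rshift n v) = 0%N) q' -> q'.@[w_ w t] = q'.@[w].
  move=> h; apply: meval_eq_supp => mu /h mv i mi; rewrite /w_; case: eqVneq => // iv.
  by rewrite iv mv in mi.
have ha' : supp_in (fun mu => mu (rshift n v) = 0%N) a.
  by apply: (sub_supp_in _ ha) => mu h; rewrite (ydeg_eq0 h).
have hb' : supp_in (fun mu => mu (rshift n v) = 0%N) b.
  apply: (sub_supp_in _ hb) => mu [_ h]; apply: contraTeq isT => /h.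
  by rewrite !inE eqxx.
have hc' : supp_in (fun mu => mu (rshift n v) = 0%N) c.
  apply: (sub_supp_in _ hc) => mu [_ h _]; apply: contraTeq isT => /h.
  by rewrite !inE eqxx.
have disc w : 0 <= a.@[w] /\ 0 <= 4 * a.@[w] * c.@[w] - b.@[w] ^+ 2.
  apply: quadratic_ge0 => t; have := q_ge0 (w_ w t).
  have wv : w_ w t (rshift n v) = t by rewrite /w_ eqxx.
  by rewrite {1}eq expr2 !mevalD !mevalM mevalXU !indep // wv expr2.
have cS' : #|S :\ v| = d by apply/eqP; rewrite -eqSS -cS (cardsD1 v S) vS.
have [a0|a0] := eqVneq a 0.
  have b0 : b = 0.
    apply: mpoly_eq0P => w; have [_] := disc w.
    rewrite a0 meval0 mulr0 mul0r sub0r oppr_ge0 => h; apply/eqP.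
    by rewrite -sqrf_eq0 eq_le h sqr_ge0.
  have qc : q = c by rewrite eq a0 b0; ring.
  by apply: (IHd _ cS') => //; rewrite qc.
have A0 : A != 0.
  by apply: contraNneq a0 => A0; rewrite -eA A0 /lift_x comp_mpoly0.
have [|rho [srho rho0 srA]] := hilbert17 (f := A).
  move=> x; pose w (i : 'I_(n + m)) := match split i with inl j => x j | inr _ => 0 end.
  have -> : A.@[x] = a.@[w].
    rewrite -eA meval_lift_x; apply: meval_eq => i.
    by rewrite /w split_lshift.
  by case: (disc w).
pose r := 4 * (a * c) - b ^+ 2.
have r_ge0 w : 0 <= r.@[w].
  have [_] := disc w; rewrite /r expr2 mevalB !mevalM -mpolyC_nat mevalC.
  by rewrite mulrA -expr2.
have hr : supp_in (yquad e (S :\ v)) r.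
  apply: supp_inD.
    rewrite -mpolyC_nat mul_mpolyC; apply: supp_inZ.
    apply: (supp_inM _ ha hc) => mu nu mu0 [nu2 nuS pat]; split.
    - by rewrite ydegD mu0.
    - exact: ysuppD (ysupp_ydeg0 _ mu0) nuS.
    - by move=> i j ij; rewrite !mnmDE !(ydeg_eq0 mu0) !add0n; exact: pat.
  (* No fill-in: distinct y-variables in a monomial of [b ^+ 2] belong to the clique [N]. *)
  apply: supp_inN; rewrite expr2; apply: (supp_inM _ hb hb) => mu nu [mu1 muN] [nu1 nuN].
  have NS (i : 'I_m) : i \in N -> i \in S :\ v by rewrite inE => /andP[].
  split.
  - by rewrite ydegD (leq_add mu1 nu1).
  - by move=> j /(ysuppD muN nuN) /NS.
  - move=> i j ij /(ysuppD muN nuN) iN /(ysuppD muN nuN) jN.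
    by move/is_cliqueP: cN; apply; rewrite ?in_setU1 ?iN ?jN ?orbT.
have [tau [stau tau0 ct]] := IHd _ cS' r r_ge0 hr.
(* [A] alone need not be a sum of squares, but [rho * A] is; the 4 comes from completing the square
   and is itself a square. *)
exists (tau * (rho * A) * 4); split.
- apply: is_sosM; first exact: is_sosM.
  have -> : (4 : {mpoly R[n]}) = 2 ^+ 2 by ring.
  exact: is_sos_sqr.
- by rewrite !mulf_neq0 // -mpolyC_nat mpolyC_eq0 pnatr_eq0.
have l4 : lift_x m (4 : {mpoly R[n]}) = 4.
  exact: (rmorph_nat (comp_mpoly [tuple 'X_(lshift m i) | i < n]) 4).
have -> : lift_x m (tau * (rho * A) * 4) * q =
    lift_x m (tau * rho) * (2 * a * 'X_(rshift n v) + b) ^+ 2 +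
    lift_x m rho * (lift_x m tau * r).
  by rewrite !lift_xM l4 eA /r eq; ring.
apply: clique_sumD; last exact: clique_sumZ.
apply: clique_sumZ; first exact: is_sosM.
apply: (clique_sum_sqr cN); apply: supp_inD; last first.
  apply: (sub_supp_in _ hb) => mu [h1 h2]; split=> // j /h2 jN.
  by rewrite in_setU1 jN orbT.
rewrite -mulrA -mpolyC_nat mul_mpolyC; apply: supp_inZ.
apply: (supp_inM _ ha (supp_inX (Q := fun mu => mu = U_(rshift n v)%MM) _)) => //.
move=> mu _ mu0 ->; split; first by rewrite ydegD mu0 ydegU.
apply: ysuppD; first exact: ysupp_ydeg0.
move=> j; rewrite mnm1E (inj_eq (@rshift_inj n m)).
by case: (eqVneq v j) => // -> _; rewrite in_setU1 eqxx.
Qed.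

End CliqueSums.

(** * Assignment of the squares to maximal cliques *)

Section LiftXY.
Variables (R : realType) (n m : nat) (A : {set 'I_m}).

Definition xy_index (i : 'I_(n + #|A|)) : 'I_(n + m) :=
  match split i with inl j => lshift m j | inr k => rshift n (enum_val k) end.

Lemma xy_index_inj : injective xy_index.
Proof.
move=> i j; rewrite /xy_index.
case: (split_ordP i) => i' ->; case: (split_ordP j) => j' ->;
  rewrite ?split_lshift ?split_rshift.
- by move=> /lshift_inj ->.
- by move=> /eqP; rewrite eq_lrshift.
- by move=> /eqP; rewrite eq_rlshift.
- by move=> /rshift_inj /enum_val_inj ->.
Qed.

Lemma lift_xyE (s : {mpoly R[n + #|A|]}) : lift_xy s = rename xy_index s.
Proof.
congr (_ \mPo _); apply: eq_from_tnth => i; rewrite !tnth_mktuple /xy_index.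
by case: (split i).
Qed.

Lemma lift_xy_surj (B : {set 'I_m}) (u : {mpoly R[n + m]}) :
  B \subset A -> supp_in (ylin B) u ->
  exists s : {mpoly R[n + #|A|]}, lift_xy s = u /\ supp_in (fun nu => (ydeg nu <= 1)%N) s.
Proof.
move=> /subsetP BA hu; have [|s es hs] := rename_surj xy_index_inj (u := u).
  move=> mu /hu[_ muB] j; case: (split_ordP j) => i -> mui.
    by exists (lshift #|A| i); rewrite /xy_index split_lshift.
  have iA := BA _ (muB _ mui).
  by exists (rshift n (enum_rank_in iA i)); rewrite /xy_index split_rshift enum_rankK_in.
exists s; split; first by rewrite lift_xyE.
move=> nu /hs[mu /hu[mu1 _] ->]; apply: leq_trans mu1.
rewrite /ydeg (eq_bigr (fun k => mu (rshift n (enum_val k)))); last first.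
  by move=> k _; rewrite mnmE /xy_index split_rshift.
rewrite -(big_enum_val (A := mem A) (fun j => mu (rshift n j))) /=.
by rewrite [X in (_ <= X)%N](bigID (mem A)) leq_addr.
Qed.

End LiftXY.

Theorem corollary4p1 (R : realType) (n m : nat) (p : {mpoly R[n + m]})
    (p_ge0 : nonneg_xy p)
    (p_quad : quadratic_y p)
    (p2_ge0 : nonneg_xy (ypart 2 p))
    (p_chordal : chordal (csgraph p))
    (t : nat) (C : 'I_t -> {set 'I_m})
    (C_inj : injective C)
    (C_max : forall A : {set 'I_m},
       max_clique (csgraph p) A <-> exists k : 'I_t, C k = A) :
  exists (sigma0 : {mpoly R[n]}) (sigma : forall k : 'I_t, {mpoly R[n + #|C k|]}),
    [/\ is_sos sigma0,
        sigma0 != 0,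
        forall k : 'I_t, is_sos (sigma k) /\ quadratic_y (sigma k)
      & lift_x m sigma0 * p = \sum_(k < t) lift_xy (sigma k)].
Proof.
have e_sym : ssrbool.symmetric (csgraph p).
  move=> i j; rewrite /csgraph /= eq_sym; congr (_ && _); rewrite !mxE eq_sym; congr (_ || _).
  by apply: eq_has => mu; rewrite mulnC.
have e_irr : irreflexive (csgraph p) by move=> i; rewrite /csgraph /= eqxx.
have hp : supp_in (yquad (csgraph p) setT) p.
  move=> mu mup; split; [exact: p_quad | by move=> j; rewrite inE|].
  move=> i j ij mui muj; rewrite /csgraph /= ij mxE; apply/orP; right.
  by apply/hasP; exists mu; rewrite // muln_eq0 negb_or mui.
have [tau [stau tau0 [s hs es]]] :=
  clique_certificate e_sym e_irr p_chordal (proj1 (nonneg_xyP p) p_ge0) hp.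
have inC A : is_clique (csgraph p) A -> exists k, A \subset C k.
  move=> /maxset_exists[B maxB AB]; have [k ek] := proj1 (C_max B) maxB.
  by exists k; rewrite ek.
(* The empty clique extends to a maximal one, so there is an index to serve as default outside
   [s]. *)
have [k0 _] := inC _ (is_clique_set0 (csgraph p)).
have kappa_ex Au : exists k, Au \in s -> Au.1 \subset C k.
  have [/hs[/inC[k Ak] _]|_] := boolP (Au \in s); last by exists k0.
  by exists k.
(* [kappa] selects for each square one maximal clique that contains its clique, although several may
   do. *)
have [kappa kappaP] := choice kappa_ex.
have root_ex k Au : exists u : {mpoly R[n + #|C k|]}, Au \in s -> kappa Au = k ->
    lift_xy u = Au.2 /\ supp_in (fun nu => (ydeg nu <= 1)%N) u.
  have [[sAu kk]|nk] := pselect (Au \in s /\ kappa Au = k); last first.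
    by exists 0 => sAu kk; case: nk.
  have [_ hu] := hs _ sAu; have [|u hu'] := lift_xy_surj (A := C k) _ hu.
    by rewrite -kk; exact: kappaP.
  by exists u.
pose rt k Au := sval (cid (root_ex k Au)).
have rtP k Au : Au \in s -> kappa Au = k ->
    lift_xy (rt k Au) = Au.2 /\ supp_in (fun nu => (ydeg nu <= 1)%N) (rt k Au).
  exact: (svalP (cid (root_ex k Au))).
exists tau, (fun k => \sum_(Au <- s | kappa Au == k) rt k Au ^+ 2); split=> //.
  move=> k; split.
    by exists [seq rt k Au | Au <- s & kappa Au == k]; rewrite big_map big_filter.
  rewrite big_seq_cond; apply: supp_in_sum => Au /andP[sAu /eqP kk].
  have [_ h] := rtP k Au sAu kk; apply: (supp_inM _ h h) => mu nu mu1 nu1.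
  by rewrite ydegD (leq_add mu1 nu1).
rewrite es [in RHS](eq_bigr (fun k => \sum_(Au <- s | kappa Au == k) Au.2 ^+ 2)); last first.
  move=> k _; rewrite [LHS]raddf_sum big_seq_cond [in RHS]big_seq_cond.
  apply: eq_bigr => Au /andP[sAu /eqP kk]; have [<- _] := rtP k Au sAu kk.
  exact: rmorphXn.
(* Each square is counted once, at the index [kappa Au]. *)
rewrite (exchange_big_dep xpredT) //=; apply: eq_bigr => Au _.
by rewrite (big_pred1 (kappa Au)) // => k; rewrite eq_sym.
Qed.
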